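(* Let $A\in\mathbb{R}^{n\times n}$ be Hurwitz, $B\in\mathbb{R}^{n\times m}$, $C\in\mathbb{R}^{p\times n}$, $\bar T>0$, and let $\hat A\in\mathbb{R}^{r\times r}$, $\hat B\in\mathbb{R}^{r\times m}$, $\hat C\in\mathbb{R}^{p\times r}$ be such that the reduced system $(\hat A,\hat B,\hat C)$ is a locally optimal approximation of $(A,B,C)$ with respect to the time-limited $\mathcal H_2$-norm, i.e. $(\hat A,\hat B,\hat C)$ is a local minimizer, among all reduced matrices of these sizes, of $\int_0^{\bar T}\|Ce^{As}B-\hat Ce^{\hat As}\hat B\|_F^2\,ds$. Assume $\hat A$ is diagonalizable, $\hat A=S^{-1}DS$ with $D=\operatorname{diag}(\lambda_1,\dots,\lambda_r)$, that $D$ and $-D$ have no common eigenvalues and that $D$ and $-A$ have no common eigenvalues. Set $\tilde B=S\hat B$, $\tilde C=\hat CS^{-1}$, and let $\tilde P_{\bar T},\tilde P_{2,\bar T},\tilde Q_{\bar T},\tilde Q_{2,\bar T},\tilde Q_\infty,\tilde Q_{2,\infty}$ be the solutions of $$A \tilde P_{2, {\bar T}}+ \tilde P_{2, {\bar T}} D =-B \tilde B^T+e^{A \bar T}B \tilde B^T e^{D \bar T},\qquad D\tilde P_{\bar T}+\tilde P_{\bar T} D =-\tilde B \tilde B^T+e^{D \bar T}\tilde B \tilde B^T e^{D \bar T},$$ $$D \tilde Q_{2, {\bar T}}+ \tilde Q_{2, {\bar T}} A =-\tilde C^T C+e^{D \bar T} \tilde C^T C e^{A \bar T},\qquad D \tilde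 Q_{\bar T}+\tilde Q_{\bar T} D =-\tilde C^T \tilde C+e^{D \bar T}\tilde C^T \tilde C e^{D \bar T},$$ $$D \tilde Q_{\infty}+\tilde Q_{\infty} D =-\tilde C^T \tilde C,\qquad D \tilde Q_{2, {\infty}}+ \tilde Q_{2, {\infty}} A =-\tilde C^T C.$$ Then (1) $\tilde C \tilde P_{\bar T} = C \tilde P_{2, \bar T}$; (2) $\tilde Q_{\bar T}\tilde B = \tilde Q_{2, \bar T} B$; (3) for all $i\in\{1,\dots,r\}$: $e_i^T\tilde Q_{2, \infty}[\tilde P_{2, {\bar T}}-\bar T e^{A\bar T}B \tilde B^T e^{D \bar T}]e_i= e_i^T\tilde Q_{\infty}[\tilde P_{\bar T}-\bar Te^{D \bar T}\tilde B \tilde B^T e^{D \bar T}]e_i$. Equivalently (with all displayed inverses assumed to exist), $$(I\otimes \hat C) \left[(I\otimes \hat A)+(D\otimes I)\right]^{-1}(e^{D \bar T}\tilde B \otimes e^{\hat A \bar T}\hat B -\tilde B \otimes \hat B) \operatorname{vec}(I) = (I\otimes C) \left[(I\otimes A)+(D\otimes I)\right]^{-1} (e^{D \bar T}\tilde B \otimes e^{ A \bar T} B -\tilde B \otimes B) \operatorname{vec}(I),$$ $$(\hat B^T\otimes I) \left[(I\otimes D)+(\hat A^T\otimes I)\right]^{-1}(e^{\hat A^T \bar T}\hat C^T \otimes e^{D \bar T}\tilde C^T-\hat C^T \otimes \tilde C^T)\operatorname{vec}(I) = (B^T\otimes I) \left[(I\otimes D)+(A^T\otimes I)\right]^{-1}(e^{A^T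 \bar T} C^T \otimes e^{D \bar T}\tilde C^T-C^T \otimes \tilde C^T)\operatorname{vec}(I),$$ and for all $i=1,\ldots,r$ $$\operatorname{vec}^T(I) (\hat C \otimes \tilde C) \left[(I\otimes D)+(\hat A\otimes I)\right]^{-1} (I\otimes e_i e_i^T)\Big( \left[(I\otimes D)+(\hat A\otimes I)\right]^{-1} (e^{\hat A \bar T}\hat B \otimes e^{D \bar T}\tilde B -\hat B \otimes \tilde B)- (\bar Te^{\hat A \bar T}\hat B \otimes e^{D \bar T}\tilde B) \Big)\operatorname{vec}(I)$$ $$=\operatorname{vec}^T(I) ( C \otimes \tilde C) \left[(I\otimes D)+(A\otimes I)\right]^{-1} (I\otimes e_i e_i^T)\Big( \left[(I\otimes D)+(A\otimes I)\right]^{-1} (e^{A \bar T} B \otimes e^{D \bar T}\tilde B -B \otimes \tilde B)-(\bar Te^{A \bar T}B \otimes e^{D \bar T}\tilde B)\Big) \operatorname{vec}(I).$$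
   Context: $e_i$ is the $i$-th column of an identity matrix, $I$ denotes identity matrices of suitable sizes, $\otimes$ is the Kronecker product, $\operatorname{vec}$ stacks the columns of a matrix into a vector, $\operatorname{vec}^T(I)=(\operatorname{vec}(I))^T$, $\|\cdot\|_F$ is the Frobenius norm. Transposes are plain (not conjugate) transposes even when $S$, $D$ are complex. *)

(* Defs.v *)
From HB Require Import structures.
From mathcomp Require Import all_boot all_order all_algebra.
From mathcomp Require Import all_classical all_reals all_analysis.
From mathcomp Require Import complex.
Set Implicit Arguments. Unset Strict Implicit. Unset Printing Implicit Defensive.
Import Order.TTheory GRing.Theory Num.Theory numFieldNormedType.Exports.
Local Open Scope ring_scope.

(* Give R[i] its standard metric topology (induced by the complex modulus,
   as MathComp-Analysis does for every numClosedFieldType), so that limits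
   can be taken in complex matrix spaces. *)
Import numFieldTopology.Exports.
HB.instance Definition _ (R : rcfType) := PseudoPointedMetric.copy R[i] (R[i])^o.

(* k-th power of a square matrix (for any size n, including 0). *)
Definition mxpow (K : pzRingType) (n : nat) (A : 'M[K]_n) (k : nat) : 'M[K]_n :=
  iter k (mulmx A) 1%:M.

Definition expmx_term (K : fieldType) (n : nat) (A : 'M[K]_n) (k : nat) : 'M[K]_n :=
  (k`!%:R)^-1 *: mxpow A k.

Definition expmxR (R : realType) (n : nat) (A : 'M[R]_n) : 'M[R]_n :=
  limn (fun N : nat => (\sum_(k < N) expmx_term A k : 'M[R]_n)).
Definition expmxC (R : realType) (n : nat) (A : 'M[R[i]]_n) : 'M[R[i]]_n :=
  limn (fun N : nat => (\sum_(k < N) expmx_term A k : 'M[R[i]]_n)).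

Definition cmx (R : rcfType) (m n : nat) (M : 'M[R]_(m, n)) : 'M[R[i]]_(m, n) :=
  map_mx (fun x => x%:C%C) M.

Definition hurwitz (R : rcfType) (n : nat) (A : 'M[R]_n) : Prop :=
  forall z : R[i], eigenvalue (cmx A) z -> complex.Re z < 0.

Definition frob2 (R : realType) (m n : nat) (M : 'M[R]_(m, n)) : R :=
  \sum_(i < m) \sum_(j < n) M i j ^+ 2.

Definition tlH2err (R : realType) (n m p r : nat)
  (A : 'M[R]_n) (B : 'M[R]_(n, m)) (C : 'M[R]_(p, n)) (T : R)
  (Ah : 'M[R]_r) (Bh : 'M[R]_(r, m)) (Ch : 'M[R]_(p, r)) : \bar R :=
  (\int[@lebesgue_measure R]_(s in `[0%R, T]%classic)
     (frob2 (C *m expmxR (s *: A) *m B - Ch *m expmxR (s *: Ah) *m Bh)%R)%:E)%E.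

Definition tlH2_locally_optimal (R : realType) (n m p r : nat)
  (A : 'M[R]_n) (B : 'M[R]_(n, m)) (C : 'M[R]_(p, n)) (T : R)
  (Ah : 'M[R]_r) (Bh : 'M[R]_(r, m)) (Ch : 'M[R]_(p, r)) : Prop :=
  exists2 eps : R, 0 < eps &
    forall (Ah' : 'M[R]_r) (Bh' : 'M[R]_(r, m)) (Ch' : 'M[R]_(p, r)),
      (forall i j, `|Ah' i j - Ah i j| < eps) ->
      (forall i j, `|Bh' i j - Bh i j| < eps) ->
      (forall i j, `|Ch' i j - Ch i j| < eps) ->
      (tlH2err A B C T Ah Bh Ch <= tlH2err A B C T Ah' Bh' Ch')%E.

(* Main.v *)
(** Differentiating the error in [Ch], [Bh] and [Ah] at a local minimizer gives
    that the integrals over [0, T] of [E (eh Bh)^T], [(Ch eh)^T E] and the trace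
    form of [s Ch^T E (eh Bh)^T] against every real matrix commuting with [Ah]
    vanish, where [e s = exp (s A)], [eh s = exp (s Ah)] and
    [E s = C (e s) B - Ch (eh s) Bh].  Commuting directions suffice: the real
    and imaginary parts of the rank-one spectral matrices [S^-1 E_ii S] are of
    this kind, and along them exp factors, so no derivative of exp in a general
    direction is needed.

    By the fundamental theorem of calculus the integrals of
    [X s = e s B (eh s Bh)^T] and its analogues solve Sylvester equations, so
    after the change of basis [S] they are the given matrices [P2T], [PT], [Q2T]
    and [QT], which proves (1) and (2).  For (3), the derivative of [s X s]
    gives [T X(T) - int X = A Z + Z Ah^T] with [Z = int s X s], and on the
    diagonal the equation of [Q2inf] moves [A] and [D] onto [Q2inf], leaving
    [Ct^T C Z]. *)
Require Import Defs.
From HB Require Import structures.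
From mathcomp Require Import all_boot all_order all_algebra.
From mathcomp Require Import all_classical all_reals all_analysis.
From mathcomp Require Import complex ring lra.
Import Order.TTheory GRing.Theory Num.Theory numFieldNormedType.Exports.
Local Open Scope classical_set_scope.
Local Open Scope ring_scope.
Set Implicit Arguments.
Unset Strict Implicit.
Unset Printing Implicit Defensive.

(** * The matrix exponential *)

(** Neighbourhoods of a matrix are generated by entrywise families of neighbourhoods, and finitely
    many eventual conditions hold simultaneously. *)
Lemma cvg_mx {X : Type} {F : set_system X} {FF : Filter F} (T : ptopologicalType)
    (m n : nat) (f : X -> 'M[T]_(m, n)) (M : 'M[T]_(m, n)) :
  (forall i j, f x i j @[x --> F] --> M i j) -> f x @[x --> F] --> M.
Proof.
move=> fM U [P nP PU].
have H : \forall x \near F, forall i j, P i j (f x i j).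
  apply: filter_forall => i; apply: filter_forall => j.
  exact: (fM i j _ (nP i j)).
by apply: filterS H => x Hx; apply: PU.
Qed.

Lemma mxpow_scale (K : comPzRingType) (n : nat) (a : K) (A : 'M[K]_n) (k : nat) :
  mxpow (a *: A) k = a ^+ k *: mxpow A k.
Proof.
elim: k => [|k IH]; first by rewrite /mxpow /= expr0 scale1r.
rewrite /mxpow /= -/(mxpow _ _) IH -/(mxpow _ _) -scalemxAr -scalemxAl scalerA.
by rewrite exprSr.
Qed.

Lemma mxpowS (K : pzRingType) (n : nat) (A : 'M[K]_n) (k : nat) :
  mxpow A k.+1 = A *m mxpow A k.
Proof. by []. Qed.

(** The sum of the moduli of all entries dominates every row sum of [A], so each further factor [A]
    multiplies the bound on the entries by at most [c]. *)
Lemma mxpow_bound (R : realDomainType) (n : nat) (A : 'M[R]_n) :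
  exists2 c : R, 0 <= c & forall k i j, `|mxpow A k i j| <= c ^+ k.
Proof.
exists (\sum_i \sum_j `|A i j|); first by do 2!(apply: sumr_ge0 => ? _).
set c := \sum_i _; elim=> [|k IH] i j.
  by rewrite /mxpow /= expr0 mxE; case: eqP; rewrite ?normr1 ?normr0.
rewrite mxpowS mxE exprS (le_trans (ler_norm_sum _ _ _))//.
apply: (@le_trans _ _ (\sum_l `|A i l| * c ^+ k)).
  by apply: ler_sum => l _; rewrite normrM ler_wpM2l.
have c0 : 0 <= c by do 2!(apply: sumr_ge0 => ? _).
rewrite -mulr_suml ler_wpM2r ?exprn_ge0// /c [leRHS](bigD1 i)//= lerDl.
by do 2!(apply: sumr_ge0 => ? _).
Qed.

(** Comparison with the scalar exponential series at [c * |x|]. *)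
Lemma is_cvg_pseries_fact (R : realType) (a : R^nat) (c : R) : 0 <= c ->
  (forall k, `|a k| <= c ^+ k / k`!%:R) -> forall x, cvgn (pseries a x).
Proof.
move=> c0 ac x; apply: normed_cvg.
apply: (series_le_cvg _ _ _ (@is_cvg_series_exp_coeff R (c * `|x|))) => [k|k|k] /=.
- by [].
- by rewrite /exp_coeff /= divr_ge0// ?exprn_ge0// mulr_ge0.
- rewrite normrM normrX /exp_coeff /= exprMn mulrAC.
  by rewrite ler_wpM2r// exprn_ge0.
Qed.

(** Coefficients of the power series in [x] of the entry [(i, j)] of [exp (x A)]; they bring the
    scalar theory of power series to bear on each entry. *)
Definition exp_entry (R : realType) (n : nat) (A : 'M[R]_n) (i j : 'I_n) (k : nat) : R :=
  mxpow A k i j / k`!%:R.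

Lemma is_cvg_exp_entry (R : realType) (n : nat) (A : 'M[R]_n) (i j : 'I_n) (x : R) :
  cvgn (pseries (exp_entry A i j) x).
Proof.
have [c c0 Hc] := mxpow_bound A.
apply: (is_cvg_pseries_fact c0) => k.
rewrite /exp_entry normrM normfV [X in _ / X]ger0_norm//.
by rewrite ler_wpM2r ?invr_ge0.
Qed.

Lemma expmx_partial_entry (R : realType) (n : nat) (A : 'M[R]_n) (i j : 'I_n) (x : R) N :
  (\sum_(k < N) expmx_term (x *: A) k : 'M[R]_n) i j = pseries (exp_entry A i j) x N.
Proof.
rewrite /pseries /series /= summxE big_mkord; apply: eq_bigr => k _.
by rewrite /expmx_term mxpow_scale !mxE /exp_entry; rewrite mulrA mulrC mulrA mulrAC.
Qed.

Lemma cvg_expmx_scale (R : realType) (n : nat) (A : 'M[R]_n) (x : R) :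
  (fun N : nat => (\sum_(k < N) expmx_term (x *: A) k : 'M[R]_n)) @ \oo -->
  (\matrix_(i, j) limn (pseries (exp_entry A i j) x)).
Proof.
apply: cvg_mx => i j; rewrite mxE.
rewrite [X in X @ _](_ : _ = pseries (exp_entry A i j) x); last first.
  by apply/funext => N; rewrite expmx_partial_entry.
exact: is_cvg_exp_entry.
Qed.

Lemma expmxR_entry (R : realType) (n : nat) (A : 'M[R]_n) (x : R) i j :
  expmxR (x *: A) i j = limn (pseries (exp_entry A i j) x).
Proof. by rewrite /expmxR (cvg_lim _ (@cvg_expmx_scale R n A x))// mxE. Qed.

Lemma cvg_pseries_lincomb (R : realType) (n : nat) (w : 'I_n -> R) (c : 'I_n -> R^nat)
    (x : R) : (forall l, cvgn (pseries (c l) x)) ->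
  pseries (fun k => \sum_l w l * c l k) x @ \oo --> \sum_l w l * limn (pseries (c l) x).
Proof.
move=> cc; have -> : pseries (fun k => \sum_l w l * c l k) x =
    (fun N => \sum_l w l * pseries (c l) x N).
  apply/funext => N; rewrite /pseries /series /=.
  under [RHS]eq_bigr do rewrite mulr_sumr.
  rewrite exchange_big; apply: eq_bigr => k _.
  by rewrite mulr_suml; apply: eq_bigr => l _; rewrite mulrA.
apply: cvg_big => [|l _]; first exact: add_continuous.
by apply: cvgMl_tmp; exact: cc.
Qed.

(** Since [(k+1) / (k+1)! = 1 / k!] and [A^(k+1) = A A^k], this is the identity
    [exp (x A)' = A exp (x A)] at the level of coefficients. *)
Lemma pseries_diffs_exp_entry (R : realType) (n : nat) (A : 'M[R]_n) i j :
  pseries_diffs (exp_entry A i j) =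
  (fun k => \sum_l A i l * exp_entry A l j k).
Proof.
apply/funext => k; rewrite /pseries_diffs /exp_entry factS natrM invfM.
rewrite mulrCA mulVKf ?pnatr_eq0//.
rewrite mxpowS mxE mulr_suml; apply: eq_bigr => l _.
by rewrite -mulrA.
Qed.

(** Taken entrywise so that scalar results (constancy under zero derivative, the fundamental theorem
    of calculus) apply to each entry directly. *)
Definition mx_derive (R : realType) (m n : nat) (F : R -> 'M[R]_(m, n)) (x : R)
    (dF : 'M[R]_(m, n)) : Prop :=
  forall i j, is_derive x 1 (fun s => F s i j) (dF i j).

Lemma mx_derive_expmxR (R : realType) (n : nat) (A : 'M[R]_n) (x : R) :
  mx_derive (fun s => expmxR (s *: A)) x (A *m expmxR (x *: A)).
Proof.
move=> i j.
have -> : (fun s => expmxR (s *: A) i j) = (fun s => limn (pseries (exp_entry A i j) s)).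
  by apply/funext => s; rewrite expmxR_entry.
have dE y : pseries (pseries_diffs (exp_entry A i j)) y @ \oo -->
    \sum_l A i l * limn (pseries (exp_entry A l j) y).
  rewrite pseries_diffs_exp_entry; apply: cvg_pseries_lincomb => l.
  exact: is_cvg_exp_entry.
have -> : (A *m expmxR (x *: A)) i j =
    limn (pseries (pseries_diffs (exp_entry A i j)) x).
  rewrite (cvg_lim _ (dE x))// mxE.
  by apply: eq_bigr => l _; rewrite expmxR_entry.
(* Termwise differentiation at [x] asks for convergence of the series and of its first two formal
   derivatives at some point of modulus larger than [|x|]; [|x| + 1] is such a point. *)
apply: (@pseries_snd_diffs _ _ (`|x| + 1)).
- exact: is_cvg_exp_entry.
- by apply/cvg_ex; eexists; exact: dE.
- have -> : pseries_diffs (pseries_diffs (exp_entry A i j)) =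
      (fun k => \sum_l A i l * \sum_q A l q * exp_entry A q j k).
    apply/funext => k; rewrite {1}/pseries_diffs pseries_diffs_exp_entry mulr_sumr.
    apply: eq_bigr => l _; rewrite mulrCA.
    by move: (congr1 (@^~ k) (pseries_diffs_exp_entry A l j)) => <-.
  apply/cvg_ex; eexists; apply: cvg_pseries_lincomb => l.
  apply/cvg_ex; eexists; apply: cvg_pseries_lincomb => q.
  exact: is_cvg_exp_entry.
- by rewrite [ltRHS]ger0_norm// ltrDl.
Qed.

Lemma mx_derive_eq (R : realType) (m n : nat) (F : R -> 'M[R]_(m, n)) x dF dG :
  mx_derive F x dF -> dF = dG -> mx_derive F x dG.
Proof. by move=> ? <-. Qed.

Lemma mx_derive_cst (R : realType) (m n : nat) (M : 'M[R]_(m, n)) x :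
  mx_derive (fun=> M) x 0.
Proof. by move=> i j; rewrite mxE; exact: is_derive_cst. Qed.

Lemma mx_deriveD (R : realType) (m n : nat) (F G : R -> 'M[R]_(m, n)) x dF dG :
  mx_derive F x dF -> mx_derive G x dG -> mx_derive (fun s => F s + G s) x (dF + dG).
Proof.
move=> hF hG i j; rewrite mxE.
rewrite (_ : (fun s => _) = (fun s => F s i j) + (fun s => G s i j)); last first.
  by apply/funext => s; rewrite mxE.
exact: is_deriveD.
Qed.

Lemma mx_derive_tr (R : realType) (m n : nat) (F : R -> 'M[R]_(m, n)) x dF :
  mx_derive F x dF -> mx_derive (fun s => (F s)^T) x dF^T.
Proof.
move=> hF i j; rewrite mxE.
by rewrite (_ : (fun s => _) = (fun s => F s j i))//; apply/funext => s; rewrite mxE.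
Qed.

Lemma mx_deriveM (R : realType) (m n p : nat) (F : R -> 'M[R]_(m, n))
    (G : R -> 'M[R]_(n, p)) x dF dG :
  mx_derive F x dF -> mx_derive G x dG ->
  mx_derive (fun s => F s *m G s) x (dF *m G x + F x *m dG).
Proof.
move=> hF hG i j.
rewrite (_ : (fun s => _) = \sum_k (fun s => F s i k * G s k j)); last first.
  by apply/funext => s; rewrite mxE fct_sumE.
rewrite !mxE -big_split /=.
apply: is_derive_sum => k.
have hFk := hF i k; have hGk := hG k j.
apply: (@is_derive_eq _ _ _ _ _ _ _ _ (is_deriveM _ _)).
by rewrite /GRing.scale /= addrC mulrC [G x k j * _]mulrC mulrC.
Qed.

Lemma mx_deriveMl (R : realType) (m n p : nat) (M : 'M[R]_(m, n))
    (G : R -> 'M[R]_(n, p)) x dG :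
  mx_derive G x dG -> mx_derive (fun s => M *m G s) x (M *m dG).
Proof.
move=> hG; apply: mx_derive_eq (mx_deriveM (mx_derive_cst M x) hG) _.
by rewrite mul0mx add0r.
Qed.

Lemma mx_deriveMr (R : realType) (m n p : nat) (M : 'M[R]_(n, p))
    (F : R -> 'M[R]_(m, n)) x dF :
  mx_derive F x dF -> mx_derive (fun s => F s *m M) x (dF *m M).
Proof.
move=> hF; apply: mx_derive_eq (mx_deriveM hF (mx_derive_cst M x)) _.
by rewrite mulmx0 addr0.
Qed.

Lemma mx_derive_scale (R : realType) (m n : nat) (F : R -> 'M[R]_(m, n)) x dF :
  mx_derive F x dF -> mx_derive (fun s => s *: F s) x (F x + x *: dF).
Proof.
move=> hF i j; have hFk := hF i j.
rewrite (_ : (fun s => _) = id * (fun s => F s i j)); last first.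
  by apply/funext => s; rewrite mxE.
apply: (@is_derive_eq _ _ _ _ _ _ _ _ (is_deriveM _ _)).
by rewrite !mxE /GRing.scale /= mulr1 addrC.
Qed.

Lemma mx_deriveN_arg (R : realType) (m n : nat) (F : R -> 'M[R]_(m, n)) x dF :
  mx_derive F (- x) dF -> mx_derive (fun s => F (- s)) x (- dF).
Proof.
move=> hF i j; have hFk := hF i j.
apply: (@is_derive_eq _ _ _ _ _ _ _ _ (@is_derive1_comp _ (fun s => F s i j) -%R x _ _ _ _)).
by rewrite mxE /GRing.scale /= mulrN1.
Qed.

Lemma mx_derive0_cst (R : realType) (m n : nat) (F : R -> 'M[R]_(m, n)) :
  (forall x, mx_derive F x 0) -> forall x y, F x = F y.
Proof.
move=> hF x y; apply/matrixP => i j.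
apply: (@is_derive_0_is_cst _ (fun s => F s i j)) => z.
by have := hF z i j; rewrite mxE.
Qed.

(** Stated over a general [numFieldType] so as to serve both real and complex matrices. *)
Lemma cvg_mulmx {X : Type} {F : set_system X} {FF : Filter F} (K : numFieldType)
    (m n p q : nat) (Y : 'M[K]_(m, n)) (Z : 'M[K]_(p, q))
    (f : X -> 'M[K]_(n, p)) (M : 'M[K]_(n, p)) :
  (forall i j, (f x i j : K^o) @[x --> F] --> (M i j : K^o)) ->
  forall i j, ((Y *m f x *m Z) i j : K^o) @[x --> F] --> ((Y *m M *m Z) i j : K^o).
Proof.
move=> fM i j.
have E (N : 'M[K]_(n, p)) : (Y *m N *m Z) i j = \sum_k (\sum_l Y i l * N l k) * Z k j.
  by rewrite mxE; apply: eq_bigr => k _; rewrite mxE.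
rewrite [X in X @ _](_ : _ = (fun x => \sum_k (\sum_l Y i l * f x l k) * Z k j : K^o)).
  rewrite E; apply: (@cvg_big K^o) => [|k _]; first exact: add_continuous.
  apply: (@cvgMr_tmp K).
  apply: (@cvg_big K^o) => [|l _]; first exact: add_continuous.
  by apply: (@cvgMl_tmp K); exact: fM.
by apply/funext => x; rewrite E.
Qed.

Arguments cvg_mulmx {X F FF K m n p q} Y Z {f M}.

Lemma cvg_expmxR_entry (R : realType) (n : nat) (A : 'M[R]_n) i j :
  (\sum_(k < N) expmx_term A k : 'M[R]_n) i j @[N --> \oo] --> expmxR A i j.
Proof.
rewrite -[A]scale1r.
rewrite [X in X @ _](_ : _ = pseries (exp_entry A i j) 1); last first.
  by apply/funext => N; rewrite expmx_partial_entry.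
rewrite expmxR_entry; exact: is_cvg_exp_entry.
Qed.

(** Every power of [X], hence every partial sum, commutes with [Y]; uniqueness of limits transfers
    this to the exponential. *)
Lemma expmxR_comm (R : realType) (n : nat) (X Y : 'M[R]_n) :
  X *m Y = Y *m X -> expmxR X *m Y = Y *m expmxR X.
Proof.
move=> XY; apply/matrixP => i j.
have H1 := cvg_mulmx 1%:M Y (@cvg_expmxR_entry R n X) i j.
have H2 := cvg_mulmx Y 1%:M (@cvg_expmxR_entry R n X) i j.
rewrite mul1mx in H1; rewrite mulmx1 in H2.
rewrite -(cvg_lim (@Rhausdorff R) (H1 _)) -(cvg_lim (@Rhausdorff R) (H2 _)).
rewrite [X in lim (X @ _) = _](_ : _ =
  (fun N => (Y *m (\sum_(k < N) expmx_term X k) *m 1%:M) i j))//.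
apply/funext => N; rewrite mul1mx mulmx1; congr (fun_of_matrix _ i j).
rewrite mulmx_suml mulmx_sumr; apply: eq_bigr => k _.
rewrite /expmx_term -scalemxAl -scalemxAr; congr (_ *: _).
elim: (k : nat) => [|l IH]; first by rewrite /mxpow /= mul1mx mulmx1.
by rewrite mxpowS -mulmxA IH !mulmxA XY.
Qed.

Lemma expmxR0 (R : realType) (n : nat) : expmxR (0 : 'M[R]_n) = 1%:M.
Proof.
apply/matrixP => i j.
rewrite -(cvg_lim (@Rhausdorff R) (@cvg_expmxR_entry R n 0 i j)).
apply: cvg_lim; first exact: Rhausdorff.
(* The partial sum is empty for [N = 0]; from [N = 1] on it is constant, as only the term [k = 0]
   survives. *)
apply: cvg_near_cst; near=> N.
have N0 : (0 < N)%N by near: N; exact: nbhs_infty_gt.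
rewrite -(prednK N0) big_ord_recl big1 ?addr0.
  by rewrite /expmx_term /mxpow /= fact0 invr1 scale1r.
by move=> k _; rewrite /expmx_term lift0 mxpowS mul0mx scaler0.
Unshelve. all: by end_near. Qed.

(** The product has zero derivative in [s] and equals the identity at [s = 0]. *)
Lemma expmxR_mulN (R : realType) (n : nat) (Z : 'M[R]_n) (s : R) :
  expmxR (- s *: Z) *m expmxR (s *: Z) = 1%:M.
Proof.
pose W s := expmxR (- s *: Z) *m expmxR (s *: Z).
have -> : 1%:M = W 0 by rewrite /W oppr0 !scale0r expmxR0 mulmx1.
apply: (@mx_derive0_cst _ _ _ W) => x.
apply: mx_derive_eq.
  apply: (mx_deriveM (mx_deriveN_arg (@mx_derive_expmxR _ _ Z (- x)))).
  exact: mx_derive_expmxR.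
rewrite -(expmxR_comm (X := - x *: Z) (Y := Z)) ?mulNmx ?mulmxA ?addNr//.
by rewrite -scalemxAl -scalemxAr.
Qed.

(** The integrating factor [exp (- x Z)] makes [exp (- x Z) W x] constant, and this factor is
    invertible. *)
Lemma mx_linear_ode_unique (R : realType) (n p : nat) (Z : 'M[R]_n) (W : R -> 'M[R]_(n, p)) :
  (forall x, mx_derive W x (Z *m W x)) -> W 0 = 0 -> forall x, W x = 0.
Proof.
move=> dW W0 x.
have H : expmxR (- x *: Z) *m W x = expmxR (- 0 *: Z) *m W 0.
  apply: (@mx_derive0_cst _ _ _ (fun s => expmxR (- s *: Z) *m W s)) => y.
  apply: mx_derive_eq.
    exact: (mx_deriveM (mx_deriveN_arg (@mx_derive_expmxR _ _ Z (- y))) (dW y)).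
  rewrite -(expmxR_comm (X := - y *: Z) (Y := Z)) ?mulNmx ?mulmxA ?addNr//.
  by rewrite -scalemxAl -scalemxAr.
rewrite W0 mulmx0 in H.
have := congr1 (mulmx (expmxR (- - x *: Z))) H.
by rewrite mulmxA expmxR_mulN mul1mx mulmx0.
Qed.

(** Both [exp (s X) exp (s Y)] and [exp (s (X + Y))] solve [W' = (X + Y) W] with value the identity
    at 0, so their difference vanishes at [s = 1]. *)
Lemma expmxRD (R : realType) (n : nat) (X Y : 'M[R]_n) :
  X *m Y = Y *m X -> expmxR (X + Y) = expmxR X *m expmxR Y.
Proof.
move=> XY; apply/eqP; rewrite eq_sym -subr_eq0; apply/eqP.
pose W s := expmxR (s *: X) *m expmxR (s *: Y) + (- 1%:M) *m expmxR (s *: (X + Y)).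
suff /(_ 1) : forall x, W x = 0 by rewrite /W !scale1r mulNmx mul1mx.
apply: (mx_linear_ode_unique (Z := X + Y)) => [x|]; last first.
  by rewrite /W !scale0r !expmxR0 mulmx1 mulNmx mul1mx subrr.
apply: mx_derive_eq.
  apply: mx_deriveD; last by apply: mx_deriveMl; exact: mx_derive_expmxR.
  by apply: mx_deriveM; exact: mx_derive_expmxR.
rewrite /W mulmxDr; congr (_ + _); last by rewrite !mulNmx !mul1mx mulmxN.
rewrite mulmxDl !mulmxA; congr (_ + _ *m _).
by apply: expmxR_comm; rewrite -scalemxAl -scalemxAr XY.
Qed.

(** * Integrals of matrix functions *)

Definition mx_cont (R : realType) (m n : nat) (F : R -> 'M[R]_(m, n)) : Prop :=
  forall i j, continuous (fun s => F s i j).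

Lemma mx_derive_cont (R : realType) (m n : nat) (F dF : R -> 'M[R]_(m, n)) :
  (forall x, mx_derive F x (dF x)) -> mx_cont F.
Proof.
move=> dFx i j x; apply: differentiable_continuous.
by apply/derivable1_diffP; have [] := dFx x i j.
Qed.

Lemma mx_cont_cst (R : realType) (m n : nat) (M : 'M[R]_(m, n)) :
  mx_cont (fun=> M).
Proof. by move=> i j; exact: cst_continuous. Qed.

Lemma mx_contM (R : realType) (m n p : nat) (F : R -> 'M[R]_(m, n))
    (G : R -> 'M[R]_(n, p)) :
  mx_cont F -> mx_cont G -> mx_cont (fun s => F s *m G s).
Proof.
move=> cF cG i j x.
rewrite (_ : (fun s => _) = (fun s => \sum_k F s i k * G s k j)); last first.
  by apply/funext => s; rewrite mxE.
apply: cvg_big => [|k _]; first exact: add_continuous.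
by apply: cvgM; [exact: cF|exact: cG].
Qed.

Lemma mx_contD (R : realType) (m n : nat) (F G : R -> 'M[R]_(m, n)) :
  mx_cont F -> mx_cont G -> mx_cont (fun s => F s + G s).
Proof.
move=> cF cG i j x.
rewrite (_ : (fun s => _) = (fun s => F s i j + G s i j)); last first.
  by apply/funext => s; rewrite mxE.
by apply: cvgD; [exact: cF|exact: cG].
Qed.

Lemma mx_contN (R : realType) (m n : nat) (F : R -> 'M[R]_(m, n)) :
  mx_cont F -> mx_cont (fun s => - F s).
Proof.
move=> cF i j x.
rewrite (_ : (fun s => _) = (fun s => - F s i j)); last first.
  by apply/funext => s; rewrite mxE.
by apply: cvgN; exact: cF.
Qed.

Lemma mx_cont_scale (R : realType) (m n : nat) (F : R -> 'M[R]_(m, n)) :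
  mx_cont F -> mx_cont (fun s => s *: F s).
Proof.
move=> cF i j x.
rewrite (_ : (fun s => _) = (fun s => s * F s i j)); last first.
  by apply/funext => s; rewrite mxE.
by apply: cvgM; [exact: cvg_id|exact: cF].
Qed.

Lemma mx_cont_tr (R : realType) (m n : nat) (F : R -> 'M[R]_(m, n)) :
  mx_cont F -> mx_cont (fun s => (F s)^T).
Proof.
move=> cF i j x.
rewrite (_ : (fun s => _) = (fun s => F s j i)); last first.
  by apply/funext => s; rewrite mxE.
exact: cF.
Qed.

Lemma mx_cont_expmxR (R : realType) (n : nat) (A : 'M[R]_n) :
  mx_cont (fun s => expmxR (s *: A)).
Proof. by apply: mx_derive_cont => x; exact: mx_derive_expmxR. Qed.

Definition int0 (R : realType) (T : R) (f : R -> R) : R :=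
  Rintegral (@lebesgue_measure R) `[0, T] f.

Lemma cont_integrable (R : realType) (T : R) (f : R -> R) : continuous f ->
  (@lebesgue_measure R).-integrable `[0, T] (EFin \o f).
Proof.
move=> cf; apply: continuous_compact_integrable; first exact: segment_compact.
exact: continuous_subspaceT.
Qed.

(** Passes from the extended-real integral in the error functional to a real one: a continuous
    integrand is integrable on a segment. *)
Lemma EFin_int0 (R : realType) (T : R) (f : R -> R) : continuous f ->
  (\int[@lebesgue_measure R]_(s in `[0%R, T]) (f s)%:E = (int0 T f)%:E)%E.
Proof.
move=> cf; rewrite /int0 /Rintegral fineK//; apply: integrable_fin_num => //.
exact: cont_integrable.
Qed.

Lemma int0D (R : realType) (T : R) (f g : R -> R) : continuous f -> continuous g ->
  int0 T (fun s => f s + g s) = int0 T f + int0 T g.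
Proof. by move=> cf cg; rewrite /int0 RintegralD//; exact: cont_integrable. Qed.

Lemma int0Zl (R : realType) (T a : R) (f : R -> R) : continuous f ->
  int0 T (fun s => a * f s) = a * int0 T f.
Proof. by move=> cf; rewrite /int0 RintegralZl//; exact: cont_integrable. Qed.

Lemma int0_cst (R : realType) (T a : R) : 0 < T -> int0 T (fun=> a) = a * T.
Proof.
move=> T0; rewrite /int0 Rintegral_cst//= lebesgue_measure_itv /= lte_fin T0.
by rewrite -EFinB /= subr0.
Qed.

Lemma int0_le (R : realType) (T : R) (f g : R -> R) : continuous f -> continuous g ->
  (forall s, 0 <= s <= T -> f s <= g s) -> int0 T f <= int0 T g.
Proof. by move=> cf cg fg; apply: le_Rintegral => //; exact: cont_integrable. Qed.

Lemma sum_continuous (R : realType) (I : Type) (r : seq I) (f : I -> R -> R) :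
  (forall i, continuous (f i)) -> continuous (fun s => \sum_(i <- r) f i s).
Proof.
by move=> cf x; apply: cvg_big => [|i _]; [exact: add_continuous|exact: cf].
Qed.

Lemma int0_sum (R : realType) (T : R) (I : Type) (r : seq I) (f : I -> R -> R) :
  (forall i, continuous (f i)) ->
  int0 T (fun s => \sum_(i <- r) f i s) = \sum_(i <- r) int0 T (f i).
Proof.
move=> cf; elim: r => [|i r IH].
  rewrite big_nil (_ : (fun s => _) = (fun s => 0 * 0)).
    by rewrite int0Zl ?mul0r//; exact: cst_continuous.
  by apply/funext => s; rewrite big_nil mul0r.
rewrite big_cons -IH -int0D//; last exact: sum_continuous.
by congr int0; apply/funext => s; rewrite big_cons.
Qed.

Lemma int0_FTC (R : realType) (T : R) (f F : R -> R) : 0 < T -> continuous f ->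
  (forall x : R, is_derive x 1 F (f x)) -> int0 T f = F T - F 0.
Proof.
move=> T0 cf dF.
have cF : continuous F.
  by move=> x; apply: differentiable_continuous; apply/derivable1_diffP; have [] := dF x.
rewrite /int0 /Rintegral (continuous_FTC2 (F := F))//.
- exact: continuous_subspaceT.
- split.
  + by move=> x _; have [] := dF x.
  + exact/cvg_at_right_filter/cF.
  + exact/cvg_at_left_filter/cF.
- by move=> x _; rewrite derive1E; have [_ ->] := dF x.
Qed.

Definition mx_int (R : realType) (T : R) (m n : nat) (F : R -> 'M[R]_(m, n)) : 'M[R]_(m, n) :=
  \matrix_(i, j) int0 T (fun s => F s i j).

Lemma mx_intD (R : realType) (T : R) (m n : nat) (F G : R -> 'M[R]_(m, n)) :
  mx_cont F -> mx_cont G ->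
  mx_int T (fun s => F s + G s) = mx_int T F + mx_int T G.
Proof.
move=> cF cG; apply/matrixP => i j; rewrite !mxE -int0D//.
by congr int0; apply/funext => s; rewrite mxE.
Qed.

Lemma mx_intMl (R : realType) (T : R) (m n p : nat) (M : 'M[R]_(m, n))
    (F : R -> 'M[R]_(n, p)) :
  mx_cont F -> mx_int T (fun s => M *m F s) = M *m mx_int T F.
Proof.
move=> cF; apply/matrixP => i j; rewrite !mxE.
rewrite (_ : (fun s => _) = (fun s => \sum_k M i k * F s k j)); last first.
  by apply/funext => s; rewrite mxE.
rewrite int0_sum => [|k x].
  by apply: eq_bigr => k _; rewrite int0Zl// mxE.
by apply: cvgMl_tmp; exact: cF.
Qed.

Lemma mx_int_tr (R : realType) (T : R) (m n : nat) (F : R -> 'M[R]_(m, n)) :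
  mx_int T (fun s => (F s)^T) = (mx_int T F)^T.
Proof.
apply/matrixP => i j; rewrite !mxE.
by congr int0; apply/funext => s; rewrite mxE.
Qed.

Lemma mx_intMr (R : realType) (T : R) (m n p : nat) (M : 'M[R]_(n, p))
    (F : R -> 'M[R]_(m, n)) :
  mx_cont F -> mx_int T (fun s => F s *m M) = mx_int T F *m M.
Proof.
move=> cF; apply: trmx_inj; rewrite trmx_mul -!mx_int_tr -mx_intMl; last exact: mx_cont_tr.
by congr (mx_int T _); apply/funext => s; rewrite trmx_mul.
Qed.

Lemma mx_int_FTC (R : realType) (T : R) (m n : nat) (F dF : R -> 'M[R]_(m, n)) : 0 < T ->
  (forall x, mx_derive F x (dF x)) -> mx_cont dF -> mx_int T dF = F T - F 0.
Proof.
move=> T0 dFx cdF; apply/matrixP => i j; rewrite !mxE.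
exact: (int0_FTC (F := fun s => F s i j) T0 (cdF i j) (fun x => dFx x i j)).
Qed.

(** Each entry is bounded on the compact segment; the sum of these finitely many bounds works for
    all entries at once. *)
Lemma mx_cont_bounded (R : realType) (T : R) (m n : nat) (F : R -> 'M[R]_(m, n)) :
  mx_cont F ->
  exists2 K : R, 0 <= K & forall s, 0 <= s <= T -> forall i j, `|F s i j| <= K.
Proof.
move=> cF.
have H i j : exists K : R, forall s, 0 <= s <= T -> `|F s i j| <= K.
  have /compact_bounded[K [_ HK]] :=
    continuous_compact (continuous_subspaceT (cF i j)) (@segment_compact R 0 T).
  exists (K + 1) => s sT; apply: (HK (K + 1)); first by rewrite ltrDl.
  by exists s.
have [K HK] := choice (fun ij : 'I_m * 'I_n => H ij.1 ij.2).
exists (\sum_ij `|K ij|); first by apply: sumr_ge0.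
move=> s sT i j; apply: le_trans (HK (i, j) s sT) _.
rewrite (bigD1 (i, j))//= (le_trans (ler_norm _))// lerDl.
exact: sumr_ge0.
Qed.

(** * First variation of an integral of squared Frobenius norms *)

Definition frob_dot (R : realType) (m n : nat) (M N : 'M[R]_(m, n)) : R :=
  \sum_i \sum_j M i j * N i j.

Lemma frob_dot_cont (R : realType) (m n : nat) (F G : R -> 'M[R]_(m, n)) :
  mx_cont F -> mx_cont G -> continuous (fun s => frob_dot (F s) (G s)).
Proof.
move=> cF cG; apply: sum_continuous => i; apply: sum_continuous => j x.
by apply: cvgM; [exact: cF|exact: cG].
Qed.

Lemma frob2_cont (R : realType) (m n : nat) (F : R -> 'M[R]_(m, n)) :
  mx_cont F -> continuous (fun s => frob2 (F s)).
Proof. by move=> cF; exact: frob_dot_cont. Qed.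

(** Write [y = x - h f + q] with [|q| <= a |h|] and expand the square. Up to the factor [a |h|], the
    term [(h f)^2] contributes [K^2], the two cross terms with [q] contribute [2 K] each, and [q^2]
    contributes 1. *)
Lemma sqr_perturb_le (R : realFieldType) (x f y K a h : R) :
  0 <= K -> 0 <= a <= 1 -> `|h| <= 1 -> `|h| <= a ->
  `|x| <= K -> `|f| <= K -> `|y - x + h * f| <= a * `|h| ->
  y ^+ 2 <= x ^+ 2 - 2 * h * (x * f) + a * `|h| * (K ^+ 2 + 4 * K + 1).
Proof.
move=> K0 /andP[a0 a1] h1 ha xK fK yxhf.
set q := y - x + h * f in yxhf; have -> : y = x - h * f + q by rewrite /q; ring.
have h0 := normr_ge0 h; set k := `|h| in h0 h1 ha yxhf *.
have hf : `|h * f| <= k * K by rewrite normrM ler_wpM2l.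
have e1 : (h * f) ^+ 2 <= (k * K) ^+ 2.
  by rewrite -real_normK ?num_real// lerXn2r ?nnegrE ?mulr_ge0.
have e2 : q ^+ 2 <= (a * k) ^+ 2.
  by rewrite -real_normK ?num_real// lerXn2r ?nnegrE ?mulr_ge0.
have e3 : x * q <= K * (a * k).
  by rewrite (le_trans (ler_norm _))// normrM ler_pM.
have e4 : - (h * f * q) <= k * K * (a * k).
  by rewrite (le_trans (ler_norm _))// normrN normrM ler_pM.
have kk : k * k <= a * k by rewrite ler_wpM2r.
have ak : 0 <= a * k by rewrite mulr_ge0.
have f1 : (k * K) ^+ 2 <= a * k * K ^+ 2.
  by rewrite exprMn expr2 ler_wpM2r// exprn_ge0.
have f2 : (a * k) ^+ 2 <= a * k.
  by rewrite expr2 ler_piMr// -[leRHS]mulr1 ler_pM.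
have f3 : k * K * (a * k) <= K * (a * k).
  by rewrite ler_wpM2r// ler_piMl.
have -> : (x - h * f + q) ^+ 2 = x ^+ 2 - 2 * h * (x * f) + (h * f) ^+ 2
   + 2 * (x * q) + 2 * (- (h * f * q)) + q ^+ 2 by ring.
lra.
Qed.

(* The fifth hypothesis says that [h |-> Eh h] has derivative [- F] at 0,
   uniformly on [0, T]. *)
Lemma first_order_condition (R : realType) (T : R) (m n : nat)
    (E F : R -> 'M[R]_(m, n)) (Eh : R -> R -> 'M[R]_(m, n)) :
  0 < T -> mx_cont E -> mx_cont F -> (forall h, mx_cont (Eh h)) ->
  (forall a : R, 0 < a -> exists2 b : R, 0 < b & forall h : R, `|h| < b ->
     forall s : R, 0 <= s <= T -> forall i j, `|(Eh h s - E s + h *: F s) i j| <= a * `|h|) ->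
  (exists2 b : R, 0 < b & forall h : R, `|h| < b ->
     int0 T (fun s => frob2 (E s)) <= int0 T (fun s => frob2 (Eh h s))) ->
  int0 T (fun s => frob_dot (E s) (F s)) = 0.
Proof.
move=> T0 cE cF cEh dEh [b0 b0_gt0 minE].
have [K1 K10 EK1] := mx_cont_bounded T cE.
have [K2 K20 FK2] := mx_cont_bounded T cF.
pose K := K1 + K2.
have K0 : 0 <= K by rewrite addr_ge0.
set L := int0 _ _.
(* The pointwise error constant summed over the [m * n] entries and integrated over an interval of
   length [T]. *)
pose c := T * (m * n)%:R * (K ^+ 2 + 4 * K + 1).
have c0 : 0 <= c.
  by rewrite mulr_ge0 ?(mulr_ge0 (ltW T0))// !addr_ge0// ?exprn_ge0// mulr_ge0.
(* Minimality is tested with [h = k] if [L >= 0] and with [h = - k] otherwise, which bounds [|L|] by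
   a multiple of [a]; the tolerance [a] is then made arbitrarily small. *)
have step a : 0 < a -> a <= 1 -> 2 * `|L| <= c * a.
  move=> a0 a1; have [b b_gt0 db] := dEh a a0.
  (* Half of the minimum lies strictly below the minimality radius [b0], the differentiability
     radius [b] and the tolerance [a]. *)
  pose k := Num.min (Num.min b0 b) a / 2.
  have k0 : 0 < k by rewrite divr_gt0// !lt_min b0_gt0 b_gt0.
  have kmin : k < Num.min (Num.min b0 b) a.
    by rewrite ltr_pdivrMr// ltr_pMr// ?ltr1n// !lt_min b0_gt0 b_gt0.
  have /andP[/andP[kb0 kb] ka] : (k < b0) && (k < b) && (k < a) by move: kmin; rewrite !lt_min.
  have main h : `|h| = k -> 2 * (h * L) <= c * a * k.
    move=> hk.
    have le1 := minE h; rewrite hk in le1; move/(_ kb0) in le1.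
    have le2 : int0 T (fun s => frob2 (Eh h s)) <=
      int0 T (fun s => frob2 (E s) + (- 2 * h) * frob_dot (E s) (F s) +
         (m * n)%:R * (a * k * (K ^+ 2 + 4 * K + 1))).
      have cL := frob_dot_cont cE cF.
      apply: int0_le; first exact: frob2_cont.
        move=> x; apply: cvgD; last exact: cvg_cst.
        apply: cvgD; first exact: frob2_cont.
        by apply: cvgMl_tmp; exact: cL.
      move=> s sT.
      have -> : (m * n)%:R * (a * k * (K ^+ 2 + 4 * K + 1)) =
         \sum_(i < m) \sum_(j < n) (a * k * (K ^+ 2 + 4 * K + 1)).
        by rewrite !sumr_const !card_ord -mulrnA mulnC mulr_natl.
      rewrite /frob2 /frob_dot mulr_sumr -!big_split/=; apply: ler_sum => i _.
      rewrite mulr_sumr -!big_split/=; apply: ler_sum => j _.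
      rewrite mulNr mulNr -hk; apply: sqr_perturb_le => //.
      - by rewrite ltW.
      - by rewrite hk (le_trans (ltW ka)).
      - by rewrite hk ltW.
      - by rewrite (le_trans (EK1 _ sT _ _))// lerDl.
      - by rewrite (le_trans (FK2 _ sT _ _))// lerDr.
      - have := db h; rewrite hk => /(_ kb s sT i j).
        by rewrite !mxE.
    have := le_trans le1 le2.
    have cL := frob_dot_cont cE cF.
    have cL2 : continuous (fun s => - 2 * h * frob_dot (E s) (F s)).
      by move=> x; apply: cvgMl_tmp; exact: cL.
    rewrite int0D; last 2 first.
    - by move=> x; apply: cvgD; [exact: frob2_cont|exact: cL2].
    - exact: cst_continuous.
    rewrite int0D//; last exact: frob2_cont.
    rewrite int0Zl// int0_cst// -/L -addrA lerDl /c; lra.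
  have [L0|L0] := leP 0 L.
    have h := main k (gtr0_norm k0).
    by rewrite -(ler_pM2l k0) mulrCA (ger0_norm L0) [leRHS]mulrC.
  have h : 2 * (- k * L) <= c * a * k by apply: main; rewrite normrN gtr0_norm.
  by rewrite -(ler_pM2l k0) mulrCA (ltr0_norm L0) mulrN -mulNr [leRHS]mulrC.
apply/eqP; rewrite -normr_eq0 eq_le normr_ge0 andbT; apply/ler_addgt0Pr => e e0.
rewrite add0r.
(* Dividing by [c + 1] rather than [c] covers the case [c = 0]. *)
pose a := Num.min 1 (e / (c + 1)).
have c1 : 0 < c + 1 by rewrite ltr_wpDl.
have a0 : 0 < a by rewrite lt_min ltr01 divr_gt0.
have a1 : a <= 1 by rewrite ge_min lexx.
have ae : (c + 1) * a <= e by rewrite mulrC -ler_pdivlMr// ge_min lexx orbT.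
have := step a a0 a1; have := normr_ge0 L; nra.
Qed.

(** The derivative of [exp (t M)] at 0 is [M]; having finitely many entries gives one radius [d] for
    all of them. *)
Lemma expmxR_first_order (R : realType) (n : nat) (M : 'M[R]_n) (e : R) : 0 < e ->
  exists2 d, 0 < d & forall t, `|t| < d -> forall i j,
    `|(expmxR (t *: M) - 1%:M - t *: M) i j| <= e * `|t|.
Proof.
move=> e0.
have H : \forall t \near (0 : R)^', forall i j,
    `|t^-1 * (expmxR (t *: M) i j - 1%:M i j) - M i j| < e.
  apply: filter_forall => i; apply: filter_forall => j.
  have [dE vE] := @mx_derive_expmxR R n M 0 i j.
  have c : h^-1 *: (expmxR ((h *: (1 : R) + 0) *: M) i j - expmxR (0 *: M) i j) @[h --> 0^'] -->
    'D_(1 : R) (fun s : R => expmxR (s *: M) i j) (0 : R) := dE.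
  rewrite vE in c; move/cvgrPdist_lt: c => /(_ _ e0); apply: filterS => t.
  rewrite distrC addr0 scale0r expmxR0 mulmx1 /GRing.scale /=.
  by rewrite mulr1.
have [d /= d0 Hd] := H.
exists d => // t td i j.
(* The difference quotient is controlled on a punctured neighbourhood only, so [t = 0] is checked by
   hand. *)
have [->|t0] := eqVneq t 0.
  by rewrite !scale0r expmxR0 subrr subr0 mxE !normr0 mulr0.
have := Hd t; rewrite /= sub0r normrN => /(_ td t0 i j) /ltW.
have tn : 0 < `|t| by rewrite normr_gt0.
rewrite -(ler_pM2r tn) -normrM mulrBl mulrAC mulVf// mul1r => h.
by rewrite !mxE mulrC; move: h; rewrite !mxE.
Qed.

(** * First-order optimality conditions *)

Lemma frob_dotE (R : realType) (m n : nat) (M N : 'M[R]_(m, n)) :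
  frob_dot M N = \tr (M^T *m N).
Proof.
rewrite /frob_dot exchange_big /mxtrace; apply: eq_bigr => j _.
by rewrite mxE; apply: eq_bigr => i _; rewrite mxE.
Qed.

Lemma frob_dot_mull (R : realType) (m n p : nat) (M : 'M[R]_(m, n))
    (N : 'M[R]_(m, p)) (G : 'M[R]_(p, n)) :
  frob_dot M (N *m G) = frob_dot (M *m G^T) N.
Proof. by rewrite !frob_dotE trmx_mul trmxK -mulmxA mulmxA mxtrace_mulC mulmxA. Qed.

Lemma frob_dot_mulr (R : realType) (m n p : nat) (M : 'M[R]_(m, n))
    (G : 'M[R]_(m, p)) (N : 'M[R]_(p, n)) :
  frob_dot M (G *m N) = frob_dot (G^T *m M) N.
Proof. by rewrite !frob_dotE trmx_mul trmxK mulmxA. Qed.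

(** Pairing with an elementary matrix reads off one entry. *)
Lemma frob_dot0_eq0 (R : realType) (m n : nat) (M : 'M[R]_(m, n)) :
  (forall N, frob_dot M N = 0) -> M = 0.
Proof.
move=> H; apply/matrixP => i j; rewrite mxE -(H (delta_mx i j)) /frob_dot.
rewrite (bigD1 i)//= (bigD1 j)//= !big1 ?addr0.
- by rewrite mxE !eqxx mulr1.
- by move=> k ki; apply: big1 => l _; rewrite mxE (negbTE ki) mulr0.
- by move=> l lj; rewrite mxE (negbTE lj) andbF mulr0.
Qed.

Lemma int0_frob_dot (R : realType) (T : R) (m n : nat) (F : R -> 'M[R]_(m, n)) N :
  mx_cont F -> int0 T (fun s => frob_dot (F s) N) = frob_dot (mx_int T F) N.
Proof.
move=> cF; have cFN i j : continuous (fun s => F s i j * N i j).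
  by move=> x; apply: cvgMr_tmp; exact: cF.
rewrite /frob_dot int0_sum => [|i]; last exact: sum_continuous.
apply: eq_bigr => i _; rewrite int0_sum//; apply: eq_bigr => j _.
rewrite mxE mulrC -(int0Zl T (N i j) (cF i j)).
by congr int0; apply/funext => s; rewrite mulrC.
Qed.

(** Controls the remainder of the perturbed exponential between its two fixed outer factors. *)
Lemma mulmx3_bound (R : realType) (m n p q : nat) (M : 'M[R]_(m, n)) (N : 'M[R]_(n, p))
    (P : 'M[R]_(p, q)) (a b c : R) : 0 <= a -> 0 <= b -> 0 <= c ->
  (forall i j, `|M i j| <= a) -> (forall i j, `|N i j| <= b) ->
  (forall i j, `|P i j| <= c) ->
  forall i j, `|(M *m N *m P) i j| <= (n * p)%:R * (a * b * c).
Proof.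
move=> a0 b0 c0 Ma Nb Pc i j; rewrite mxE (le_trans (ler_norm_sum _ _ _))//.
rewrite (_ : (n * p)%:R * _ = \sum_(k < p) n%:R * (a * b) * c); last first.
  by rewrite sumr_const card_ord natrM -mulr_natl; ring.
apply: ler_sum => k _; rewrite normrM ler_pM//.
rewrite mxE (le_trans (ler_norm_sum _ _ _))//.
rewrite (_ : n%:R * _ = \sum_(l < n) a * b); last first.
  by rewrite sumr_const card_ord mulr_natl.
by apply: ler_sum => l _; rewrite normrM ler_pM.
Qed.

Section OptimalityConditions.
Context (R : realType) (n m p r : nat).
Context (A : 'M[R]_n) (B : 'M[R]_(n, m)) (C : 'M[R]_(p, n)) (T : R).
Context (Ah : 'M[R]_r) (Bh : 'M[R]_(r, m)) (Ch : 'M[R]_(p, r)).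

Definition impulse_err (Ah' : 'M[R]_r) (Bh' : 'M[R]_(r, m)) (Ch' : 'M[R]_(p, r)) (s : R) :=
  C *m expmxR (s *: A) *m B - Ch' *m expmxR (s *: Ah') *m Bh'.

Lemma impulse_err_cont Ah' Bh' Ch' : mx_cont (impulse_err Ah' Bh' Ch').
Proof.
apply: mx_contD; last apply: mx_contN;
  (apply: mx_contM; last exact: mx_cont_cst); apply: mx_contM; try exact: mx_cont_cst;
  exact: mx_cont_expmxR.
Qed.

Lemma tlH2errE Ah' Bh' Ch' :
  tlH2err A B C T Ah' Bh' Ch' =
  (int0 T (fun s => frob2 (impulse_err Ah' Bh' Ch' s)))%:E.
Proof.
exact: (EFin_int0 T (frob2_cont (@impulse_err_cont Ah' Bh' Ch'))).
Qed.

Hypothesis T0 : 0 < T.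
Hypothesis opt : tlH2_locally_optimal A B C T Ah Bh Ch.

Let E := impulse_err Ah Bh Ch.

(** The box in the definition of a local minimizer contains a short segment in every direction. *)
Lemma optimality_direction (dA : 'M[R]_r) (dB : 'M[R]_(r, m)) (dC : 'M[R]_(p, r)) :
  exists2 b : R, 0 < b & forall h : R, `|h| < b ->
    int0 T (fun s => frob2 (E s)) <=
    int0 T (fun s => frob2 (impulse_err (Ah + h *: dA) (Bh + h *: dB) (Ch + h *: dC) s)).
Proof.
have [eps eps0 Hopt] := opt.
have bnd (k l : nat) (N : 'M[R]_(k, l)) : exists2 K : R, 0 < K & forall i j, `|N i j| <= K.
  (* The added 1 keeps the bound positive for a zero direction, so that the radius [eps / K] below
     is positive. *)
  exists (1 + \sum_i \sum_j `|N i j|).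
    by rewrite ltr_pwDl//; do 2!apply: sumr_ge0 => ? _.
  move=> i j; rewrite (bigD1 i)//= (bigD1 j)//= ler_wpDl// -addrA lerDl.
  by rewrite addr_ge0//; do ?apply: sumr_ge0 => ? _.
have [KA KA0 HA] := bnd _ _ dA; have [KB KB0 HB] := bnd _ _ dB.
have [KC KC0 HC] := bnd _ _ dC.
pose K := KA + KB + KC.
have K0 : 0 < K by rewrite !addr_gt0.
have small (k l : nat) (N dN : 'M[R]_(k, l)) h (K' : R) : K' <= K ->
    (forall i j, `|dN i j| <= K') -> `|h| < eps / K ->
    forall i j, `|(N + h *: dN) i j - N i j| < eps.
  move=> K'K HN hK i j; rewrite !mxE addrC addKr normrM.
  rewrite (le_lt_trans (ler_wpM2l _ (HN i j)))//.
  rewrite (le_lt_trans (ler_wpM2l _ K'K))//.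
  by rewrite -ltr_pdivlMr.
exists (eps / K); first by rewrite divr_gt0.
move=> h hK.
have := Hopt (Ah + h *: dA) (Bh + h *: dB) (Ch + h *: dC).
rewrite !tlH2errE lee_fin; apply.
- by apply: (small _ _ _ _ _ KA) => //; rewrite /K -addrA lerDl addr_ge0// ltW.
- by apply: (small _ _ _ _ _ KB) => //; rewrite /K addrAC lerDr addr_ge0// ltW.
- by apply: (small _ _ _ _ _ KC) => //; rewrite /K lerDr addr_ge0// ltW.
Qed.

Lemma impulse_cont : mx_cont (fun s => expmxR (s *: Ah) *m Bh).
Proof. by apply: mx_contM; [exact: mx_cont_expmxR|exact: mx_cont_cst]. Qed.

(** Here [x] is the full-order impulse response, [y] the reduced one, [w] the perturbed reduced one
    and [z] the expected first-order change of [y]. *)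
Lemma sub_perturb (V : zmodType) (x w y z : V) : x - w - (x - y) + z = - (w - y - z).
Proof.
rewrite !opprB [x - w]addrC addrACA subrr addr0 [- w + y]addrC.
exact: addrC.
Qed.

(** The error is affine in [Ch], so the first-order expansion has zero remainder and any radius will
    do. As [dC] is arbitrary, the whole gradient vanishes. *)
Lemma optimality_C :
  mx_int T (fun s => E s *m (expmxR (s *: Ah) *m Bh)^T) = 0.
Proof.
apply: frob_dot0_eq0 => dC.
rewrite -int0_frob_dot; last first.
  by apply: mx_contM; [exact: impulse_err_cont|exact/mx_cont_tr/impulse_cont].
rewrite (_ : (fun s => _) = (fun s => frob_dot (E s) (dC *m (expmxR (s *: Ah) *m Bh)))); last first.
  by apply/funext => s; rewrite frob_dot_mull.
apply: (first_order_condition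
  (Eh := fun h => impulse_err (Ah + h *: 0) (Bh + h *: 0) (Ch + h *: dC))) => //.
- exact: impulse_err_cont.
- by apply: mx_contM; [exact: mx_cont_cst|exact: impulse_cont].
- by move=> h; exact: impulse_err_cont.
- move=> a a0; exists 1 => // h _ s _ i j.
  rewrite !scaler0 !addr0.
  suff -> : impulse_err Ah Bh (Ch + h *: dC) s - E s +
      h *: (dC *m (expmxR (s *: Ah) *m Bh)) = 0 by rewrite mxE normr0 mulr_ge0// ltW.
  rewrite /E /impulse_err !mulmxDl -!scalemxAl -!mulmxA.
  set x := C *m _; set y := Ch *m _; set z := h *: _.
  by rewrite sub_perturb [y + z]addrC addrK subrr oppr0.
- exact: optimality_direction.
Qed.

(** The error is affine in [Bh] too, so again the remainder is zero. *)
Lemma optimality_B :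
  mx_int T (fun s => (Ch *m expmxR (s *: Ah))^T *m E s) = 0.
Proof.
have cCh : mx_cont (fun s => Ch *m expmxR (s *: Ah)).
  by apply: mx_contM; [exact: mx_cont_cst|exact: mx_cont_expmxR].
apply: frob_dot0_eq0 => dB.
rewrite -int0_frob_dot; last first.
  by apply: mx_contM; [exact: mx_cont_tr|exact: impulse_err_cont].
rewrite (_ : (fun s => _) = (fun s => frob_dot (E s) (Ch *m expmxR (s *: Ah) *m dB))); last first.
  by apply/funext => s; rewrite frob_dot_mulr.
apply: (first_order_condition
  (Eh := fun h => impulse_err (Ah + h *: 0) (Bh + h *: dB) (Ch + h *: 0))) => //.
- exact: impulse_err_cont.
- by apply: mx_contM => //; exact: mx_cont_cst.
- by move=> h; exact: impulse_err_cont.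
- move=> a a0; exists 1 => // h _ s _ i j.
  rewrite !scaler0 !addr0.
  suff -> : impulse_err Ah (Bh + h *: dB) Ch s - E s +
      h *: (Ch *m expmxR (s *: Ah) *m dB) = 0 by rewrite mxE normr0 mulr_ge0// ltW.
  rewrite /E /impulse_err !mulmxDr -!scalemxAr.
  set x := C *m _ *m _; set y := Ch *m _ *m Bh; set z := h *: _.
  by rewrite sub_perturb [y + z]addrC addrK subrr oppr0.
- exact: optimality_direction.
Qed.

(* Only directions commuting with [Ah] are needed, and for these the
   exponential of the perturbed matrix factors. *)
Lemma optimality_A (M : 'M[R]_r) : Ah *m M = M *m Ah ->
  frob_dot (mx_int T (fun s => s *: (Ch^T *m E s *m (expmxR (s *: Ah) *m Bh)^T))) M = 0.
Proof.
move=> AM.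
have cCh : mx_cont (fun s => Ch *m expmxR (s *: Ah)).
  by apply: mx_contM; [exact: mx_cont_cst|exact: mx_cont_expmxR].
rewrite -int0_frob_dot; last first.
  apply: mx_cont_scale; apply: mx_contM; last exact/mx_cont_tr/impulse_cont.
  by apply: mx_contM; [exact: mx_cont_cst|exact: impulse_err_cont].
have eM s : expmxR (s *: Ah) *m M = M *m expmxR (s *: Ah).
  by apply: expmxR_comm; rewrite -scalemxAl -scalemxAr AM.
rewrite (_ : (fun s => _) = (fun s =>
  frob_dot (E s) (s *: (Ch *m expmxR (s *: Ah) *m (M *m Bh))))); last first.
  apply/funext => s.
  have -> : s *: (Ch *m expmxR (s *: Ah) *m (M *m Bh)) =
      Ch *m (s *: M) *m (expmxR (s *: Ah) *m Bh).
    rewrite -scalemxAr -scalemxAl; congr (_ *: _).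
    by rewrite -!mulmxA [expmxR _ *m (M *m Bh)]mulmxA eM !mulmxA.
  rewrite frob_dot_mull frob_dot_mulr !frob_dotE mulmxA.
  by rewrite linearZ /= -scalemxAl -scalemxAr.
apply: (first_order_condition
  (Eh := fun h => impulse_err (Ah + h *: M) (Bh + h *: 0) (Ch + h *: 0))) => //.
- exact: impulse_err_cont.
- by apply: mx_cont_scale; apply: mx_contM => //; exact: mx_cont_cst.
- by move=> h; exact: impulse_err_cont.
- move=> a a0.
  have [K K0 HK] := mx_cont_bounded T cCh.
  have [L L0 HL] := mx_cont_bounded T (@mx_cont_cst R _ _ Bh).
  have LB : forall i j, `|Bh i j| <= L by apply: (HL 0); rewrite lexx ltW.
  (* Bound for the remainder of the exponential between its outer factors: [K] and [L] bound their
     entries, [r * r] counts the terms, and [T] comes from [|s h| <= T |h|]. *)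
  pose c := (r * r)%:R * (K * L * T).
  have c0 : 0 <= c by rewrite mulr_ge0// !mulr_ge0// ltW.
  have c1 : 0 < c + 1 by rewrite ltr_wpDl.
  (* The tolerance [a / (c + 1)] leaves a final factor [c / (c + 1) <= 1]; the radius [d / T] then
     keeps [|s h| < d] for all [s] in [[0, T]]. *)
  have [d d0 Hd] := expmxR_first_order M (divr_gt0 a0 c1).
  exists (d / T); first by rewrite divr_gt0.
  move=> h hd s /andP[s0 sT] i j.
  have shT : `|s * h| <= T * `|h| by rewrite normrM ler_wpM2r// ger0_norm.
  have shd : `|s * h| < d by rewrite (le_lt_trans shT)// mulrC -ltr_pdivlMr.
  (* By commutation [exp (s (Ah + h M)) = exp (s Ah) exp (s h M)], so only the first-order remainder
     of [exp (s h M)] is left. *)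
  have -> : impulse_err (Ah + h *: M) (Bh + h *: 0) (Ch + h *: 0) s - E s +
      h *: (s *: (Ch *m expmxR (s *: Ah) *m (M *m Bh))) =
      (Ch *m expmxR (s *: Ah)) *m (- (expmxR ((s * h) *: M) - 1%:M - (s * h) *: M)) *m Bh.
    rewrite !scaler0 !addr0 /E /impulse_err scalerDr scalerA expmxRD; last first.
      by rewrite -!scalemxAl -!scalemxAr AM !scalerA mulrC.
    rewrite mulmxN mulNmx !mulmxBr mulmx1 !mulmxBl -scalemxAr -scalemxAl !mulmxA.
    by rewrite sub_perturb scalerA [s * h]mulrC.
  have ac0 : 0 <= a / (c + 1) by rewrite ltW// divr_gt0.
  have XK : forall i j, `|(Ch *m expmxR (s *: Ah)) i j| <= K by apply: HK; rewrite s0.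
  set N := - _.
  have Nb : forall i j, `|N i j| <= a / (c + 1) * (T * `|h|).
    move=> k l; rewrite mxE normrN (le_trans (Hd _ shd k l))//.
    by rewrite ler_wpM2l.
  have b0 : 0 <= a / (c + 1) * (T * `|h|) by rewrite mulr_ge0// mulr_ge0// ltW.
  apply: le_trans (mulmx3_bound K0 b0 L0 XK Nb LB i j) _.
  rewrite (_ : _ * _ = c / (c + 1) * (a * `|h|)); last by rewrite /c; ring.
  apply: ler_piMl; first by rewrite mulr_ge0// ltW.
  by rewrite ler_pdivrMr// mul1r lerDl.
- exact: optimality_direction.
Qed.

End OptimalityConditions.

(** * Sylvester equations satisfied by integrals over [[0, T]] *)

Lemma int_sylvester (R : realType) (T : R) (n r : nat) (A1 : 'M[R]_n) (A2 : 'M[R]_r)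
    (X : R -> 'M[R]_(n, r)) : 0 < T ->
  (forall s, mx_derive X s (A1 *m X s + X s *m A2)) ->
  A1 *m mx_int T X + mx_int T X *m A2 = X T - X 0.
Proof.
move=> T0 dX; have cX := mx_derive_cont dX.
have cl : mx_cont (fun s => A1 *m X s) by apply: mx_contM => //; exact: mx_cont_cst.
have cr : mx_cont (fun s => X s *m A2) by apply: mx_contM => //; exact: mx_cont_cst.
by rewrite -mx_intMl// -mx_intMr// -mx_intD// (mx_int_FTC T0 dX)//; exact: mx_contD.
Qed.

(** Integration by parts: the weight [s] kills the boundary term at 0 and produces the unweighted
    integral. *)
Lemma int_sylvester_weighted (R : realType) (T : R) (n r : nat) (A1 : 'M[R]_n) (A2 : 'M[R]_r)
    (X : R -> 'M[R]_(n, r)) : 0 < T ->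
  (forall s, mx_derive X s (A1 *m X s + X s *m A2)) ->
  A1 *m mx_int T (fun s => s *: X s) + mx_int T (fun s => s *: X s) *m A2 =
  T *: X T - mx_int T X.
Proof.
move=> T0 dX; have cX := mx_derive_cont dX.
have csX := mx_cont_scale cX.
have cl : mx_cont (fun s => A1 *m (s *: X s)) by apply: mx_contM => //; exact: mx_cont_cst.
have cr : mx_cont (fun s => (s *: X s) *m A2) by apply: mx_contM => //; exact: mx_cont_cst.
apply/eqP; rewrite eq_sym subr_eq -mx_intMl// -mx_intMr// -!mx_intD//; last exact: mx_contD.
have dsX s : mx_derive (fun s => s *: X s) s (A1 *m (s *: X s) + (s *: X s) *m A2 + X s).
  apply: mx_derive_eq (mx_derive_scale (dX s)) _.
  by rewrite scalerDr addrC -scalemxAr -scalemxAl.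
rewrite (mx_int_FTC T0 dsX) ?scale0r ?subr0//.
by apply: mx_contD => //; exact: mx_contD.
Qed.

Lemma mx_derive_gramian (R : realType) (n k r : nat) (A1 : 'M[R]_n) (A2 : 'M[R]_r)
    (B1 : 'M[R]_(n, k)) (B2 : 'M[R]_(r, k)) s :
  let X s := expmxR (s *: A1) *m B1 *m (expmxR (s *: A2) *m B2)^T in
  mx_derive X s (A1 *m X s + X s *m A2^T).
Proof.
move=> X.
have d1 := mx_deriveMr B1 (@mx_derive_expmxR _ _ A1 s).
have d2 := mx_derive_tr (mx_deriveMr B2 (@mx_derive_expmxR _ _ A2 s)).
apply: mx_derive_eq (mx_deriveM d1 d2) _.
by rewrite /X -[A2 *m _ *m _]mulmxA [(A2 *m _)^T]trmx_mul !mulmxA.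
Qed.

(** Differentiation leaves each generator between the output matrix and the exponential; commuting
    it past the exponential brings it to the outside. *)
Lemma mx_derive_obs_gramian (R : realType) (n k r : nat) (A1 : 'M[R]_n) (A2 : 'M[R]_r)
    (C1 : 'M[R]_(k, n)) (C2 : 'M[R]_(k, r)) s :
  let X s := (C2 *m expmxR (s *: A2))^T *m (C1 *m expmxR (s *: A1)) in
  mx_derive X s (A2^T *m X s + X s *m A1).
Proof.
move=> X.
have e k' (Z : 'M[R]_k') : Z *m expmxR (s *: Z) = expmxR (s *: Z) *m Z.
  by symmetry; apply: expmxR_comm; rewrite -scalemxAl -scalemxAr.
have d1 := mx_deriveMl C1 (@mx_derive_expmxR _ _ A1 s).
have d2 := mx_derive_tr (mx_deriveMl C2 (@mx_derive_expmxR _ _ A2 s)).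
apply: mx_derive_eq (mx_deriveM d2 d1) _.
by rewrite /X !e [C2 *m (_ *m A2)]mulmxA [(C2 *m _ *m A2)^T]trmx_mul !mulmxA.
Qed.

(** * Complexification and Sylvester equations *)

(** Eigenvalues are defined through row vectors, but the characteristic polynomial is invariant
    under transposition. *)
Lemma eigenvalue_trmx (K : fieldType) (n : nat) (A : 'M[K]_n) (z : K) :
  eigenvalue A^T z = eigenvalue A z.
Proof.
rewrite !eigenvalue_root_char; congr (root _ _).
rewrite /char_poly -[RHS]det_tr; congr (\det _).
by apply/matrixP => i j; rewrite !mxE eq_sym.
Qed.

Lemma eigenvalue_diag_mx (K : fieldType) (r : nat) (d : 'rV[K]_r) (i : 'I_r) :
  eigenvalue (diag_mx d) (d 0 i).
Proof.
apply/eigenvalueP; exists (delta_mx 0 i).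
  apply/rowP => j; rewrite mul_mx_diag !mxE eqxx /=.
  by have [->|_] := eqVneq j i; rewrite ?mulr0 ?mul0r// mulrC.
by apply/eqP => /rowP/(_ i); rewrite !mxE !eqxx => /eqP; rewrite oner_eq0.
Qed.

(** A nonzero row [i] of the difference of two solutions would be a left eigenvector of [- A] for
    the eigenvalue [d 0 i]. *)
Lemma sylvester_diagl_unique (K : fieldType) (n r : nat) (A : 'M[K]_n) (d : 'rV[K]_r)
    (M : 'M[K]_(r, n)) (Q Q' : 'M[K]_(r, n)) :
  (forall z, eigenvalue (diag_mx d) z -> ~~ eigenvalue (- A) z) ->
  diag_mx d *m Q + Q *m A = M -> diag_mx d *m Q' + Q' *m A = M -> Q = Q'.
Proof.
move=> sep QM Q'M; apply/eqP; rewrite -subr_eq0; apply/eqP.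
have H : diag_mx d *m (Q - Q') + (Q - Q') *m A = 0.
  by rewrite mulmxBr mulmxBl addrACA -opprD QM Q'M subrr.
apply/row_matrixP => i; rewrite row0; apply/eqP.
apply: contraNT (sep _ (eigenvalue_diag_mx d i)) => rn0.
apply/eigenvalueP; exists (row i (Q - Q')) => //.
have /(congr1 (row i)) := H.
rewrite row0 linearD /= !row_mul mulmxN => /eqP.
rewrite addr_eq0 => /eqP <-.
by rewrite row_diag_mx -scalemxAl -rowE.
Qed.

Lemma sylvester_diagr_unique (K : fieldType) (n r : nat) (A : 'M[K]_n) (d : 'rV[K]_r)
    (M : 'M[K]_(n, r)) (P P' : 'M[K]_(n, r)) :
  (forall z, eigenvalue (diag_mx d) z -> ~~ eigenvalue (- A) z) ->
  A *m P + P *m diag_mx d = M -> A *m P' + P' *m diag_mx d = M -> P = P'.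
Proof.
move=> sep PM P'M; apply: trmx_inj.
apply: (@sylvester_diagl_unique _ _ _ A^T d M^T).
- move=> z /sep; apply: contra; rewrite -(eigenvalue_trmx (- A)).
  by rewrite (_ : (- A)^T = - A^T)// linearN.
- by rewrite -PM linearD /= !trmx_mul tr_diag_mx addrC.
- by rewrite -P'M linearD /= !trmx_mul tr_diag_mx addrC.
Qed.

(** On the diagonal, right multiplication by [diag_mx d] agrees with left multiplication, so [A] and
    the diagonal matrix can both be moved from [W] onto [Q]. Off the diagonal the factors [d 0 i]
    and [d 0 j] differ in general, whence the restriction to entries [(i, i)]. *)
Lemma diag_sylvester_entry (K : comPzRingType) (n r : nat) (A : 'M[K]_n) (d : 'rV[K]_r)
    (M Q : 'M[K]_(r, n)) (W : 'M[K]_(n, r)) (i : 'I_r) :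
  diag_mx d *m Q + Q *m A = - M ->
  (Q *m (A *m W + W *m diag_mx d)) i i = - (M *m W) i i.
Proof.
move=> QM; rewrite mulmxDr mxE.
have -> : (Q *m (W *m diag_mx d)) i i = (diag_mx d *m Q *m W) i i.
  by rewrite mulmxA mul_mx_diag [LHS]mxE -mulmxA mul_diag_mx [RHS]mxE mulrC.
have -> : - (M *m W) i i = (- M *m W) i i by rewrite mulNmx [RHS]mxE.
by rewrite -QM mulmxDl [RHS]mxE addrC mulmxA.
Qed.

Lemma cmxM (R : rcfType) (m n p : nat) (M : 'M[R]_(m, n)) (N : 'M[R]_(n, p)) :
  cmx (M *m N) = cmx M *m cmx N.
Proof. exact: (map_mxM (real_complex R)). Qed.

Lemma cmxD (R : rcfType) (m n : nat) (M N : 'M[R]_(m, n)) :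
  cmx (M + N) = cmx M + cmx N.
Proof. exact: (map_mxD (real_complex R)). Qed.

Lemma cmxB (R : rcfType) (m n : nat) (M N : 'M[R]_(m, n)) :
  cmx (M - N) = cmx M - cmx N.
Proof. exact: (map_mxB (real_complex R)). Qed.

Lemma cmxZ (R : rcfType) (m n : nat) (a : R) (M : 'M[R]_(m, n)) :
  cmx (a *: M) = (a%:C)%C *: cmx M.
Proof. exact: (map_mxZ (real_complex R)). Qed.

Lemma cmx_tr (R : rcfType) (m n : nat) (M : 'M[R]_(m, n)) : cmx M^T = (cmx M)^T.
Proof. by apply/matrixP => i j; rewrite !mxE. Qed.

Lemma cmxE (R : rcfType) (m n : nat) (M : 'M[R]_(m, n)) i j : cmx M i j = ((M i j)%:C)%C.
Proof. exact: mxE. Qed.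

Lemma cmx1 (R : rcfType) (n : nat) : cmx (1%:M : 'M[R]_n) = 1%:M.
Proof. exact: (map_mx1 (real_complex R)). Qed.

Lemma cmx_sum (R : rcfType) (m n N : nat) (F : 'I_N -> 'M[R]_(m, n)) :
  cmx (\sum_k F k) = \sum_k cmx (F k).
Proof.
apply: (big_morph (@cmx R m n) (@cmxD R m n)).
by apply/matrixP => i j; rewrite !mxE.
Qed.

(* Otherwise unification unfolds [cmx] when rewriting products. *)
Local Opaque cmx.

Lemma cvg_real_complex (R : realType) (u : R^nat) (l : R) : u @ \oo --> l ->
  ((u k)%:C%C : R[i]^o) @[k --> \oo] --> (l%:C%C : R[i]^o).
Proof.
move=> /cvgrPdist_lt ul; apply/(@cvgrPdist_lt R[i] R[i]^o) => e e0.
(* In the order of [R[i]], [0 < e] forces [e] to be real, so its real part is a usable tolerance. *)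
have e1 : 0 < complex.Re e by move: e0; rewrite ltcE => /andP[].
apply: filterS (ul _ e1) => k.
rewrite -rmorphB /= normc_def /= expr0n /= addr0 sqrtr_sqr => h.
by case: e e0 e1 h => a b; rewrite ltcE /= => /andP[/eqP -> _] _; rewrite ltcR.
Qed.

Lemma expmx_term_similar (R : realType) (r : nat) (X : 'M[R]_r) (S Si Y : 'M[R[i]]_r) (k : nat) :
  S *m Si = 1%:M -> cmx X = Si *m Y *m S ->
  expmx_term Y k = S *m cmx (expmx_term X k) *m Si.
Proof.
move=> SSi XY; rewrite /expmx_term cmxZ -scalemxAr -scalemxAl fmorphV /= rmorph_nat.
congr (_ *: _); elim: k => [|k IH].
  by rewrite /mxpow /= cmx1 mulmx1 SSi.
by rewrite !mxpowS IH cmxM XY !mulmxA SSi mul1mx.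
Qed.

Lemma cvg_expmxC_similar (R : realType) (r : nat) (X : 'M[R]_r) (S Si Y : 'M[R[i]]_r) i j :
  S *m Si = 1%:M -> cmx X = Si *m Y *m S ->
  ((\sum_(k < N) expmx_term Y k : 'M[R[i]]_r) i j : R[i]^o) @[N --> \oo] -->
  ((S *m cmx (expmxR X) *m Si) i j : R[i]^o).
Proof.
move=> SSi XY.
rewrite [X in X @ _](_ : _ =
  (fun N => (S *m cmx (\sum_(k < N) expmx_term X k) *m Si) i j : R[i]^o)); last first.
  apply/funext => N; congr (fun_of_matrix _ i j).
  rewrite cmx_sum mulmx_sumr mulmx_suml; apply: eq_bigr => k _.
  exact: expmx_term_similar.
apply: cvg_mulmx => k l; rewrite cmxE.
rewrite [X in X @ _](_ : _ =
  (fun N => (((\sum_(k < N) expmx_term X k) k l)%:C)%C : R[i]^o)); last first.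
  by apply/funext => N; rewrite cmxE.
by apply: cvg_real_complex; exact: cvg_expmxR_entry.
Qed.

(** The partial sums for [Y] are conjugates of those for the real matrix [X], so convergence of the
    complex series is inherited from the real one. *)
Lemma expmxC_similar (R : realType) (r : nat) (X : 'M[R]_r) (S Si Y : 'M[R[i]]_r) :
  S *m Si = 1%:M -> cmx X = Si *m Y *m S ->
  expmxC Y = S *m cmx (expmxR X) *m Si.
Proof.
move=> SSi XY; rewrite /expmxC.
have H : (fun N : nat => (\sum_(k < N) expmx_term Y k : 'M[R[i]]_r)) @ \oo -->
  (S *m cmx (expmxR X) *m Si).
  by apply: cvg_mx => i j; exact: cvg_expmxC_similar.
apply: cvg_lim H.
exact: (@norm_hausdorff R[i] 'M[R[i]^o]_r).
Qed.

Lemma expmx_term_tr (K : fieldType) (n : nat) (Y : 'M[K]_n) k :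
  (expmx_term Y k)^T = expmx_term Y^T k.
Proof.
rewrite /expmx_term linearZ /=; congr (_ *: _).
elim: k => [|k IH]; first by rewrite /mxpow /= trmx1.
rewrite !mxpowS trmx_mul IH.
elim: (k) => [|l IHl]; first by rewrite /mxpow /= mul1mx mulmx1.
by rewrite mxpowS -mulmxA IHl.
Qed.

(** The partial sums of a symmetric [Y] are symmetric, so the entries [(i, j)] and [(j, i)] have the
    same limit. *)
Lemma expmxC_sym (R : realType) (r : nat) (X : 'M[R]_r) (S Si Y : 'M[R[i]]_r) :
  S *m Si = 1%:M -> cmx X = Si *m Y *m S -> Y^T = Y -> (expmxC Y)^T = expmxC Y.
Proof.
move=> SSi XY Ysym; rewrite (expmxC_similar SSi XY); apply/matrixP => i j; rewrite mxE.
have hd : hausdorff_space R[i]^o by exact: norm_hausdorff.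
have H1 := cvg_expmxC_similar (i := i) (j := j) SSi XY.
have := cvg_expmxC_similar (i := j) (j := i) SSi XY.
rewrite [X in X @ _ --> _](_ : _ =
  (fun N => (\sum_(k < N) expmx_term Y k : 'M[R[i]]_r) i j : R[i]^o)); last first.
  apply/funext => N; rewrite !summxE; apply: eq_bigr => k _.
  by rewrite -{1}Ysym -expmx_term_tr mxE.
by move=> H2; rewrite -(cvg_lim hd H1) -(cvg_lim hd H2).
Qed.

(** * Optimality conditions in terms of time-limited Gramians *)

Definition cross_gramian (R : realType) (n k r : nat) (A1 : 'M[R]_n) (B1 : 'M[R]_(n, k))
    (A2 : 'M[R]_r) (B2 : 'M[R]_(r, k)) (s : R) : 'M[R]_(n, r) :=
  expmxR (s *: A1) *m B1 *m (expmxR (s *: A2) *m B2)^T.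

(** Integrand of the dual, observability Gramian; the reduced factor stands on the left to match the
    shape of [Q2T]. *)
Definition cross_obs_gramian (R : realType) (n k r : nat) (A1 : 'M[R]_n) (C1 : 'M[R]_(k, n))
    (A2 : 'M[R]_r) (C2 : 'M[R]_(k, r)) (s : R) : 'M[R]_(r, n) :=
  (C2 *m expmxR (s *: A2))^T *m (C1 *m expmxR (s *: A1)).

Lemma mx_cont_cross_gramian (R : realType) (n k r : nat) (A1 : 'M[R]_n) (B1 : 'M[R]_(n, k))
    (A2 : 'M[R]_r) (B2 : 'M[R]_(r, k)) : mx_cont (cross_gramian A1 B1 A2 B2).
Proof. apply: mx_derive_cont => s; exact: mx_derive_gramian. Qed.

Lemma mx_cont_cross_obs_gramian (R : realType) (n k r : nat) (A1 : 'M[R]_n)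
    (C1 : 'M[R]_(k, n)) (A2 : 'M[R]_r) (C2 : 'M[R]_(k, r)) :
  mx_cont (cross_obs_gramian A1 C1 A2 C2).
Proof. apply: mx_derive_cont => s; exact: mx_derive_obs_gramian. Qed.

Lemma mx_int_lincomb (R : realType) (T : R) (m n p q : nat) (M : 'M[R]_(p, m))
    (N : 'M[R]_(p, q)) (F : R -> 'M[R]_(m, n)) (G : R -> 'M[R]_(q, n)) :
  mx_cont F -> mx_cont G ->
  mx_int T (fun s => M *m F s - N *m G s) = M *m mx_int T F - N *m mx_int T G.
Proof.
move=> cF cG; rewrite -!mulNmx -mx_intMl// -mx_intMl// -mx_intD; first last.
- by apply: mx_contM => //; exact: mx_cont_cst.
- by apply: mx_contM => //; exact: mx_cont_cst.
by congr mx_int; apply/funext => s; rewrite mulNmx.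
Qed.

Section RealConditions.
Context (R : realType) (n m p r : nat).
Context (A : 'M[R]_n) (B : 'M[R]_(n, m)) (C : 'M[R]_(p, n)) (T : R).
Context (Ah : 'M[R]_r) (Bh : 'M[R]_(r, m)) (Ch : 'M[R]_(p, r)).
Hypothesis T0 : 0 < T.
Hypothesis opt : tlH2_locally_optimal A B C T Ah Bh Ch.

Let X := cross_gramian A B Ah Bh.
Let Y := cross_gramian Ah Bh Ah Bh.
Let U := cross_obs_gramian A C Ah Ch.
Let V := cross_obs_gramian Ah Ch Ah Ch.

Lemma impulse_errX s :
  impulse_err A B C Ah Bh Ch s *m (expmxR (s *: Ah) *m Bh)^T = C *m X s - Ch *m Y s.
Proof. by rewrite /impulse_err /X /Y /cross_gramian mulmxBl !mulmxA. Qed.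

Lemma gramian_optimality_C : C *m mx_int T X = Ch *m mx_int T Y.
Proof.
apply/eqP; rewrite -subr_eq0 -mx_int_lincomb; [|exact: mx_cont_cross_gramian..].
apply/eqP; rewrite -(optimality_C T0 opt).
by congr mx_int; apply/funext => s; rewrite impulse_errX.
Qed.

Lemma gramian_optimality_B : mx_int T U *m B = mx_int T V *m Bh.
Proof.
have cU : mx_cont U by exact: mx_cont_cross_obs_gramian.
have cV : mx_cont V by exact: mx_cont_cross_obs_gramian.
have cc (k l : nat) (F : R -> 'M[R]_(r, k)) (M : 'M[R]_(k, l)) :
    mx_cont F -> mx_cont (fun s => F s *m M).
  by move=> cF; apply: mx_contM => //; exact: mx_cont_cst.
apply/eqP; rewrite -subr_eq0 -mulmxN -!mx_intMr// -mx_intD; [|exact: cc..].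
apply/eqP; rewrite -(optimality_B T0 opt).
congr mx_int; apply/funext => s; rewrite /impulse_err mulmxBr mulmxN.
by rewrite /U /V /cross_obs_gramian !mulmxA.
Qed.

Lemma gramian_optimality_A (M : 'M[R]_r) : Ah *m M = M *m Ah ->
  frob_dot (Ch^T *m (C *m mx_int T (fun s => s *: X s) -
                     Ch *m mx_int T (fun s => s *: Y s))) M = 0.
Proof.
move=> AM; rewrite -(optimality_A T0 opt AM).
have cX : mx_cont (fun s => s *: X s) by apply/mx_cont_scale/mx_cont_cross_gramian.
have cY : mx_cont (fun s => s *: Y s) by apply/mx_cont_scale/mx_cont_cross_gramian.
congr frob_dot; rewrite -mx_int_lincomb// -mx_intMl; last first.
  by apply: mx_contD; last apply: mx_contN; apply: mx_contM => //; exact: mx_cont_cst.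
congr mx_int; apply/funext => s.
by rewrite -mulmxA impulse_errX -!scalemxAr -scalerBr -scalemxAr.
Qed.

End RealConditions.

(** * From real to complex commuting directions *)

Lemma Re_sum (R : rcfType) (I : Type) (s : seq I) (F : I -> R[i]) :
  complex.Re (\sum_(i <- s) F i) = \sum_(i <- s) complex.Re (F i).
Proof. by apply: (big_morph (@complex.Re R)) => // -[a b] [c d]. Qed.

Lemma Im_sum (R : rcfType) (I : Type) (s : seq I) (F : I -> R[i]) :
  complex.Im (\sum_(i <- s) F i) = \sum_(i <- s) complex.Im (F i).
Proof. by apply: (big_morph (@complex.Im R)) => // -[a b] [c d]. Qed.

Lemma ReM_real (R : rcfType) (x : R) (z : R[i]) :
  complex.Re (x%:C%C * z) = x * complex.Re z.
Proof. by case: z => a b; rewrite /= mul0r subr0. Qed.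

Lemma ImM_real (R : rcfType) (x : R) (z : R[i]) :
  complex.Im (x%:C%C * z) = x * complex.Im z.
Proof. by case: z => a b; rewrite /= mul0r addr0. Qed.

Lemma map_Re_mull (R : rcfType) (m n p : nat) (A : 'M[R]_(m, n)) (M : 'M[R[i]]_(n, p)) :
  map_mx (@complex.Re R) (cmx A *m M) = A *m map_mx (@complex.Re R) M.
Proof.
apply/matrixP => i j; rewrite !mxE Re_sum; apply: eq_bigr => k _.
by rewrite !(cmxE, mxE) ReM_real.
Qed.

Lemma map_Re_mulr (R : rcfType) (m n p : nat) (A : 'M[R]_(n, p)) (M : 'M[R[i]]_(m, n)) :
  map_mx (@complex.Re R) (M *m cmx A) = map_mx (@complex.Re R) M *m A.
Proof.
apply/matrixP => i j; rewrite !mxE Re_sum; apply: eq_bigr => k _.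
by rewrite !(cmxE, mxE) mulrC ReM_real mulrC.
Qed.

Lemma map_Im_mull (R : rcfType) (m n p : nat) (A : 'M[R]_(m, n)) (M : 'M[R[i]]_(n, p)) :
  map_mx (@complex.Im R) (cmx A *m M) = A *m map_mx (@complex.Im R) M.
Proof.
apply/matrixP => i j; rewrite !mxE Im_sum; apply: eq_bigr => k _.
by rewrite !(cmxE, mxE) ImM_real.
Qed.

Lemma map_Im_mulr (R : rcfType) (m n p : nat) (A : 'M[R]_(n, p)) (M : 'M[R[i]]_(m, n)) :
  map_mx (@complex.Im R) (M *m cmx A) = map_mx (@complex.Im R) M *m A.
Proof.
apply/matrixP => i j; rewrite !mxE Im_sum; apply: eq_bigr => k _.
by rewrite !(cmxE, mxE) mulrC ImM_real mulrC.
Qed.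

(* The real and imaginary parts of a complex matrix commuting with a real one
   commute with it too. *)
Lemma frob_dot_centralizer (R : realType) (r : nat) (Ah N : 'M[R]_r) (M : 'M[R[i]]_r) :
  (forall M' : 'M[R]_r, Ah *m M' = M' *m Ah -> frob_dot N M' = 0) ->
  cmx Ah *m M = M *m cmx Ah -> \sum_k \sum_l cmx N k l * M k l = 0.
Proof.
move=> H AM.
apply/eqP; rewrite eq_complex; apply/andP; split; apply/eqP.
  rewrite Re_sum -[RHS](H (map_mx (@complex.Re R) M)); last first.
    by rewrite -map_Re_mull AM map_Re_mulr.
  apply: eq_bigr => k _; rewrite Re_sum; apply: eq_bigr => l _.
  by rewrite !(cmxE, mxE) ReM_real.
rewrite Im_sum -[RHS](H (map_mx (@complex.Im R) M)); last first.
  by rewrite -map_Im_mull AM map_Im_mulr.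
apply: eq_bigr => k _; rewrite Im_sum; apply: eq_bigr => l _.
by rewrite !(cmxE, mxE) ImM_real.
Qed.

(* The matrices [PX], [PY], [QU], [QV], [ZX], [ZY] stand for the integrals over
   [0, T] of [X], [Y], [U], [V] and of [s X], [s Y]. *)
Lemma spectral_optimality (K : fieldType) (n m p r : nat)
    (A eA : 'M[K]_n) (B : 'M[K]_(n, m)) (C : 'M[K]_(p, n)) (T : K)
    (Ah eh : 'M[K]_r) (Bh : 'M[K]_(r, m)) (Ch : 'M[K]_(p, r))
    (S Si : 'M[K]_r) (d : 'rV[K]_r) (eD : 'M[K]_r)
    (PX ZX : 'M[K]_(n, r)) (PY ZY : 'M[K]_r) (QU : 'M[K]_(r, n)) (QV : 'M[K]_r)
    (P2T : 'M[K]_(n, r)) (PT : 'M[K]_r) (Q2T : 'M[K]_(r, n)) (QT : 'M[K]_r)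
    (Qinf : 'M[K]_r) (Q2inf : 'M[K]_(r, n)) :
  let D := diag_mx d in
  let Bt := S *m Bh in
  let Ct := Ch *m Si in
  S *m Si = 1%:M -> Si *m S = 1%:M -> Ah = Si *m D *m S ->
  eD = S *m eh *m Si -> eD^T = eD ->
  (forall z, eigenvalue D z -> ~~ eigenvalue (- D) z) ->
  (forall z, eigenvalue D z -> ~~ eigenvalue (- A) z) ->
  A *m PX + PX *m Ah^T = eA *m B *m (eh *m Bh)^T - B *m Bh^T ->
  Ah *m PY + PY *m Ah^T = eh *m Bh *m (eh *m Bh)^T - Bh *m Bh^T ->
  Ah^T *m QU + QU *m A = (Ch *m eh)^T *m (C *m eA) - Ch^T *m C ->
  Ah^T *m QV + QV *m Ah = (Ch *m eh)^T *m (Ch *m eh) - Ch^T *m Ch ->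
  A *m ZX + ZX *m Ah^T = T *: (eA *m B *m (eh *m Bh)^T) - PX ->
  Ah *m ZY + ZY *m Ah^T = T *: (eh *m Bh *m (eh *m Bh)^T) - PY ->
  C *m PX = Ch *m PY -> QU *m B = QV *m Bh ->
  (forall M, Ah *m M = M *m Ah ->
     \sum_k \sum_l (Ch^T *m (C *m ZX - Ch *m ZY)) k l * M k l = 0) ->
  A *m P2T + P2T *m D = - (B *m Bt^T) + eA *m B *m Bt^T *m eD ->
  D *m PT + PT *m D = - (Bt *m Bt^T) + eD *m Bt *m Bt^T *m eD ->
  D *m Q2T + Q2T *m A = - (Ct^T *m C) + eD *m Ct^T *m C *m eA ->
  D *m QT + QT *m D = - (Ct^T *m Ct) + eD *m Ct^T *m Ct *m eD ->
  D *m Qinf + Qinf *m D = - (Ct^T *m Ct) ->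
  D *m Q2inf + Q2inf *m A = - (Ct^T *m C) ->
  [/\ Ct *m PT = C *m P2T,
      QT *m Bt = Q2T *m B
    & forall i : 'I_r,
        (Q2inf *m (P2T - T *: (eA *m B *m Bt^T *m eD))) i i
        = (Qinf *m (PT - T *: (eD *m Bt *m Bt^T *m eD))) i i].
Proof.
move=> D Bt Ct SSi SiS AhS eD_E eD_t sepD sepA PXE PYE QUE QVE ZXE ZYE optC optB optA.
move=> eP2T ePT eQ2T eQT eQinf eQ2inf.
have Dt : D^T = D by rewrite tr_diag_mx.
(* Intertwining relations: [S] carries [Ah] to [D] and [eh] to [eD]. Their transposed forms rely on
   [D] and [eD] being symmetric under the plain transpose. *)
have DS : D *m S = S *m Ah by rewrite AhS !mulmxA SSi mul1mx.
have SiD : Si *m D = Ah *m Si by rewrite AhS -[RHS]mulmxA SSi mulmx1.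
have StD : S^T *m D = Ah^T *m S^T by rewrite -{1}Dt -trmx_mul DS trmx_mul.
have DSit : D *m Si^T = Si^T *m Ah^T by rewrite -{1}Dt -trmx_mul SiD trmx_mul.
have eS : eD *m S = S *m eh by rewrite eD_E -mulmxA SiS mulmx1.
have Sie : Si *m eD = eh *m Si by rewrite eD_E !mulmxA SiS mul1mx.
have Ste : S^T *m eD = eh^T *m S^T by rewrite -{1}eD_t -trmx_mul eS trmx_mul.
have eSit : eD *m Si^T = Si^T *m eh^T by rewrite -{1}eD_t -trmx_mul Sie trmx_mul.
have BtT : Bt^T = Bh^T *m S^T by rewrite trmx_mul.
have CtT : Ct^T = Si^T *m Ch^T by rewrite trmx_mul.
(* The boundary terms at time [T], after the change of basis, become the exponential terms of the
   given equations. *)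
have XT : eA *m B *m (eh *m Bh)^T *m S^T = eA *m B *m Bt^T *m eD.
  by rewrite BtT trmx_mul -[RHS]mulmxA -[_ *m S^T *m eD]mulmxA Ste !mulmxA.
have YT : S *m (eh *m Bh *m (eh *m Bh)^T) *m S^T = eD *m Bt *m Bt^T *m eD.
  rewrite BtT /Bt trmx_mul [eD *m (S *m _)]mulmxA eS.
  by rewrite -[RHS]mulmxA -[_ *m S^T *m eD]mulmxA Ste !mulmxA.
have UT : Si^T *m ((Ch *m eh)^T *m (C *m eA)) = eD *m Ct^T *m C *m eA.
  by rewrite CtT trmx_mul [eD *m (_ *m _)]mulmxA eSit !mulmxA.
have VT : Si^T *m ((Ch *m eh)^T *m (Ch *m eh)) *m Si = eD *m Ct^T *m Ct *m eD.
  rewrite CtT /Ct trmx_mul [eD *m (_ *m _)]mulmxA eSit.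
  by rewrite -[RHS]mulmxA -[_ *m Si *m eD]mulmxA Sie !mulmxA.
(* Each transformed integral solves the same Sylvester equation as the given matrix, and the
   spectral separation makes the solution unique. *)
have P2TE : P2T = PX *m S^T.
  apply: (sylvester_diagr_unique sepA eP2T); rewrite -/D -XT BtT [B *m _]mulmxA.
  by rewrite [RHS]addrC -mulmxBl -PXE mulmxDl -!mulmxA StD.
have PTE : PT = S *m PY *m S^T.
  apply: (sylvester_diagr_unique sepD ePT); rewrite -/D -YT BtT /Bt.
  rewrite [S *m Bh *m _]mulmxA -[S *m Bh *m Bh^T]mulmxA [RHS]addrC -mulmxBl -mulmxBr.
  by rewrite -PYE mulmxDr mulmxDl -!mulmxA StD !mulmxA DS.
have Q2TE : Q2T = Si^T *m QU.
  apply: (sylvester_diagl_unique sepA eQ2T); rewrite -/D -UT CtT -[_ *m C]mulmxA.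
  by rewrite [RHS]addrC -mulmxBr -QUE mulmxDr !mulmxA DSit.
have QTE : QT = Si^T *m QV *m Si.
  apply: (sylvester_diagl_unique sepD eQT); rewrite -/D -VT CtT /Ct.
  rewrite [Si^T *m Ch^T *m _]mulmxA -[Si^T *m Ch^T *m Ch]mulmxA [RHS]addrC -mulmxBl.
  by rewrite -mulmxBr -QVE mulmxDr mulmxDl -!mulmxA SiD !mulmxA DSit.
split.
- by rewrite PTE P2TE /Ct -!mulmxA [Si *m _]mulmxA SiS mul1mx !mulmxA optC.
- by rewrite QTE Q2TE /Bt -!mulmxA [Si *m _]mulmxA SiS mul1mx optB.
(* [W] and [W'] are the weighted integrals in the new basis; their Sylvester equations turn both
   brackets of (3) into [- (A W + W D)] and [- (D W' + W' D)]. *)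
move=> i; pose W := ZX *m S^T; pose W' := S *m ZY *m S^T.
have WE : P2T - T *: (eA *m B *m Bt^T *m eD) = - (A *m W + W *m D).
  rewrite -XT P2TE -opprB scalemxAl -mulmxBl -ZXE mulmxDl.
  by rewrite /W -!mulmxA StD.
have WE' : PT - T *: (eD *m Bt *m Bt^T *m eD) = - (D *m W' + W' *m D).
  rewrite -YT PTE -opprB scalemxAl scalemxAr -mulmxBl -mulmxBr -ZYE mulmxDr mulmxDl.
  by rewrite /W' -!mulmxA StD !mulmxA DS.
rewrite WE WE' !mulmxN [LHS]mxE [RHS]mxE.
rewrite (diag_sylvester_entry _ _ eQ2inf) (diag_sylvester_entry _ _ eQinf) !opprK.
apply/eqP; rewrite -subr_eq0; apply/eqP.
set N := Ch^T *m _ in optA.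
have -> : (Ct^T *m C *m W) i i - (Ct^T *m Ct *m W') i i = (Si^T *m N *m S^T) i i.
  have -> : Si^T *m N *m S^T = Ct^T *m C *m W - Ct^T *m Ct *m W'.
    have CtW' : Ct *m W' = Ch *m ZY *m S^T.
      by rewrite /Ct /W' !mulmxA -[_ *m Si *m S]mulmxA SiS mulmx1.
    rewrite -[Ct^T *m Ct *m _]mulmxA CtW' -[Ct^T *m _ *m W]mulmxA -mulmxBr.
    by rewrite [C *m W]mulmxA -mulmxBl CtT /N !mulmxA.
  by rewrite [RHS]mxE [X in _ = _ + X]mxE.
(* This diagonal entry is the pairing of [N] with the rank-one spectral projector of [Ah] for the
   index [i]. It commutes with [Ah] because [delta_mx i i] commutes with [D]. *)
have -> : (Si^T *m N *m S^T) i i =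
    \sum_k \sum_l N k l * (Si *m delta_mx i i *m S) k l.
  rewrite mxE exchange_big; apply: eq_bigr => l _; rewrite mxE mulr_suml.
  apply: eq_bigr => k _.
  have -> : (Si *m delta_mx i i *m S) k l = Si k i * S i l.
    rewrite mxE (bigD1 i)//= big1 ?addr0 => [|q qi].
      rewrite mxE (bigD1 i)//= big1 ?addr0 => [|q qi]; first by rewrite mxE !eqxx mulr1.
      by rewrite mxE (negbTE qi) mulr0.
    rewrite mxE big1 ?mul0r// => q' _.
    by rewrite mxE (negbTE qi) andbF mulr0.
  by rewrite !mxE mulrCA mulrA.
apply: optA.
have Ddelta : D *m delta_mx i i = delta_mx i i *m D.
  apply/matrixP => k l; rewrite mul_diag_mx mul_mx_diag !mxE.
  have [->|_] := eqVneq k i; have [->|_] := eqVneq l i; rewrite ?mulr0 ?mul0r//.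
  by rewrite mulrC.
by rewrite !mulmxA -SiD -!mulmxA -DS ![_ *m (D *m S)]mulmxA -Ddelta !mulmxA.
Qed.

Unset Implicit Arguments.
Local Close Scope classical_set_scope.

(** The spectral data [S] and [d] may be complex even for real [Ah], so the conclusions live over
    [R[i]] and real matrices enter through [cmx]. The scalars [e_i^T M e_i] of (3) are written as
    the entries [M i i]. *)
Theorem theorem3p2 (R : realType) (n m p r : nat)
  (A : 'M[R]_n) (B : 'M[R]_(n, m)) (C : 'M[R]_(p, n)) (T : R)
  (Ah : 'M[R]_r) (Bh : 'M[R]_(r, m)) (Ch : 'M[R]_(p, r))
  (S : 'M[R[i]]_r) (d : 'rV[R[i]]_r)
  (P2T : 'M[R[i]]_(n, r)) (PT : 'M[R[i]]_r)
  (Q2T : 'M[R[i]]_(r, n)) (QT : 'M[R[i]]_r)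
  (Qinf : 'M[R[i]]_r) (Q2inf : 'M[R[i]]_(r, n)) :
  hurwitz A -> 0 < T ->
  tlH2_locally_optimal A B C T Ah Bh Ch ->
  S \in unitmx ->
  cmx Ah = invmx S *m diag_mx d *m S ->
  (forall z, eigenvalue (diag_mx d) z -> ~~ eigenvalue (- diag_mx d) z) ->
  (forall z, eigenvalue (diag_mx d) z -> ~~ eigenvalue (- cmx A) z) ->
  let D := diag_mx d in
  let Bt := S *m cmx Bh in
  let Ct := cmx Ch *m invmx S in
  let eDT := expmxC ((T%:C)%C *: D) in
  let eAT := cmx (expmxR (T *: A)) in
  cmx A *m P2T + P2T *m D = - (cmx B *m Bt^T) + eAT *m cmx B *m Bt^T *m eDT ->
  D *m PT + PT *m D = - (Bt *m Bt^T) + eDT *m Bt *m Bt^T *m eDT ->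
  D *m Q2T + Q2T *m cmx A = - (Ct^T *m cmx C) + eDT *m Ct^T *m cmx C *m eAT ->
  D *m QT + QT *m D = - (Ct^T *m Ct) + eDT *m Ct^T *m Ct *m eDT ->
  D *m Qinf + Qinf *m D = - (Ct^T *m Ct) ->
  D *m Q2inf + Q2inf *m cmx A = - (Ct^T *m cmx C) ->
  [/\ Ct *m PT = cmx C *m P2T,
      QT *m Bt = Q2T *m cmx B
    & forall i : 'I_r,
        (Q2inf *m (P2T - (T%:C)%C *: (eAT *m cmx B *m Bt^T *m eDT))) i i
        = (Qinf *m (PT - (T%:C)%C *: (eDT *m Bt *m Bt^T *m eDT))) i i].
Proof.
move=> _ T0 opt uS AhS sepD sepA D Bt Ct eDT eAT.
have SSi := mulmxV uS; have SiS := mulVmx uS.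
(* [T *: Ah] and [T *: D] are similar through the same [S], which makes [eDT] a conjugate of a real
   exponential. *)
have TAh : cmx (T *: Ah) = invmx S *m ((T%:C)%C *: D) *m S.
  by rewrite cmxZ AhS -scalemxAr -scalemxAl.
have eDT_E : eDT = S *m cmx (expmxR (T *: Ah)) *m invmx S by exact: expmxC_similar SSi TAh.
have eDT_t : eDT^T = eDT by apply: (expmxC_sym SSi TAh); rewrite linearZ /= tr_diag_mx.
have cmx_sylv (k l : nat) (A1 : 'M[R]_k) (A2 : 'M[R]_l) (P M N : 'M[R]_(k, l)) :
    A1 *m P + P *m A2 = M - N -> cmx A1 *m cmx P + cmx P *m cmx A2 = cmx M - cmx N.
  by rewrite -!cmxM -cmxD -cmxB => ->.
have gram0 (k : nat) (A1 : 'M[R]_k) B1 : cross_gramian A1 B1 Ah Bh 0 = B1 *m Bh^T.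
  by rewrite /cross_gramian !scale0r !expmxR0 !mul1mx.
have obs0 (k : nat) (A1 : 'M[R]_k) C1 : cross_obs_gramian A1 C1 Ah Ch 0 = Ch^T *m C1.
  by rewrite /cross_obs_gramian !scale0r !expmxR0 !mulmx1.
have dX := @mx_derive_gramian R _ _ _ A Ah B Bh.
have dY := @mx_derive_gramian R _ _ _ Ah Ah Bh Bh.
have dU := @mx_derive_obs_gramian R _ _ _ A Ah C Ch.
have dV := @mx_derive_obs_gramian R _ _ _ Ah Ah Ch Ch.
(* The purely algebraic lemma is applied to the complexified real integrals; its remaining
   hypotheses are their Sylvester equations and the three optimality conditions. *)
apply: (spectral_optimality SSi SiS AhS eDT_E eDT_t sepD sepA
  (PX := cmx (mx_int T (cross_gramian A B Ah Bh)))
  (PY := cmx (mx_int T (cross_gramian Ah Bh Ah Bh)))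
  (QU := cmx (mx_int T (cross_obs_gramian A C Ah Ch)))
  (QV := cmx (mx_int T (cross_obs_gramian Ah Ch Ah Ch)))
  (ZX := cmx (mx_int T (fun s => s *: cross_gramian A B Ah Bh s)))
  (ZY := cmx (mx_int T (fun s => s *: cross_gramian Ah Bh Ah Bh s)))).
- have := cmx_sylv _ _ _ _ _ _ _ (int_sylvester T0 dX).
  by rewrite -/(cross_gramian A B Ah Bh 0) gram0 !(cmxM, cmx_tr).
- have := cmx_sylv _ _ _ _ _ _ _ (int_sylvester T0 dY).
  by rewrite -/(cross_gramian Ah Bh Ah Bh 0) gram0 !(cmxM, cmx_tr).
- have := cmx_sylv _ _ _ _ _ _ _ (int_sylvester T0 dU).
  by rewrite -/(cross_obs_gramian A C Ah Ch 0) obs0 !(cmxM, cmx_tr).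
- have := cmx_sylv _ _ _ _ _ _ _ (int_sylvester T0 dV).
  by rewrite -/(cross_obs_gramian Ah Ch Ah Ch 0) obs0 !(cmxM, cmx_tr).
- by have := cmx_sylv _ _ _ _ _ _ _ (int_sylvester_weighted T0 dX); rewrite cmxZ !(cmxM, cmx_tr).
- by have := cmx_sylv _ _ _ _ _ _ _ (int_sylvester_weighted T0 dY); rewrite cmxZ !(cmxM, cmx_tr).
- by rewrite -!cmxM (gramian_optimality_C T0 opt).
- by rewrite -!cmxM (gramian_optimality_B T0 opt).
- rewrite -cmx_tr -!cmxM -cmxB -cmxM => M.
  by apply: frob_dot_centralizer => M' ; exact: gramian_optimality_A.
Qed.
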